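(* Let $R$ be a strong Mori domain. The following statements are equivalent: (i) $R$ is Clifford $t$-regular (respectively, Boole $t$-regular) of $t$-dimension one; (ii) $R$ is $t$-stable (respectively, strongly $t$-stable); (iii) $R$ is Clifford $t$-regular (respectively, Boole $t$-regular) and the $t$-maximal ideals of $R$ are $t$-stable.
   Context: Let $R$ be an integral domain with field of fractions $K$. An ideal of $R$ means a nonzero fractional ideal; it is integral if it is contained in $R$. For $R$-submodules $I,J$ of $K$, $(J:I):=\{x\in K: xI\subseteq J\}$. For an ideal $I$: $I^v:=(R:(R:I))$; $I^t:=\bigcup\{J^v : J\subseteq I \text{ a finitely generated ideal}\}$; $I^w:=\bigcap_{M\in t\text{-}\mathrm{Max}(R)}IR_M$, where $t\text{-}\mathrm{Max}(R)$, the set of $t$-maximal ideals, is the set of maximal elements among the proper integral ideals with $I=I^t$ (they are prime). A $w$-ideal (respectively $t$-ideal) is an ideal with $I=I^w$ (respectively $I=I^t$). $R$ is strong Mori if it satisfies the ascending chain condition on integral $w$-ideals. The $t$-dimension of $R$ is the supremum of the lengths $n$ of chains $(0)\subsetneq P_1\subsetneq\dots\subsetneq P_n$ with all $P_i$ nonzero prime $t$-ideals. An ideal $I$ of $R$ is: (Clifford) $t$-regular if $I^t=(I^2J)^t$ for some ideal $J$ of $R$; Boole $t$-regular if $(I^2)^t=xI^t$ for some $0\neq x\in K$; $t$-stable if, with $E:=(I^t:I^t)$, $(I^t(E:I^t))^t=E$ ($t$ being the operation of $R$; fractional ideals of $E$ are fractional ideals of $R$); strongly $t$-stable if $I^t=xE$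 for some $x\in K$, with $E=(I^t:I^t)$. $R$ is Clifford $t$-regular, Boole $t$-regular, $t$-stable, strongly $t$-stable if every ideal of $R$ has the corresponding property.
   Formalization: R is additionally assumed not to be a field: for a field, (ii) and (iii) hold trivially while the t-dimension is 0, so (i) fails and the stated equivalence is false. *)

(* Defs.v *)
From mathcomp Require Export all_boot all_order all_algebra.
From mathcomp Require Export all_classical.

Set Implicit Arguments.
Unset Strict Implicit.
Unset Printing Implicit Defensive.

Import GRing.Theory.

#[global] Open Scope ring_scope.
#[global] Open Scope classical_set_scope.

Section StarOperations.
Variable R : idomainType.
Local Notation K := {fraction R}.
Local Notation "a %:F" := (@FracField.tofrac R a).
Implicit Types (I J E M P : set K) (x : K).

(** The domain [R], seen as a subset of its field of fractions. *)
Definition baseR : set K := range (fun a : R => a%:F).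

Definition submodule I : Prop :=
  [/\ I 0,
      (forall x y, I x -> I y -> I (x + y)) &
      (forall (a : R) x, I x -> I (a%:F * x))].

(** An "ideal" is a nonzero fractional ideal; an integral ideal is one that is
    moreover contained in [R]. *)
Definition ideal I : Prop :=
  [/\ submodule I,
      (exists2 x, I x & x != 0) &
      (exists2 d : R, d != 0 & forall x, I x -> baseR (d%:F * x))].

Definition integral_ideal I : Prop := ideal I /\ I `<=` baseR.

Definition span n (g : 'I_n -> K) : set K :=
  [set x | exists a : 'I_n -> R, x = \sum_(i < n) (a i)%:F * g i].

Definition fg_ideal J : Prop :=
  ideal J /\ exists n, exists g : 'I_n -> K, J = span g.

(** Product of submodules: finite sums of products. *)
Definition prodI I J : set K :=
  [set x | exists n, exists a b : 'I_n -> K,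
     (forall i, I (a i) /\ J (b i)) /\ x = \sum_(i < n) a i * b i].

Definition scaleI x I : set K := [set x * y | y in I].

(** [colon J I] is [(J : I)], computed in the field of fractions. *)
Definition colon J I : set K := [set x | forall y, I y -> J (x * y)].

Definition v_closure I : set K := colon baseR (colon baseR I).

Definition t_closure I : set K :=
  \bigcup_(J in [set J | fg_ideal J /\ J `<=` I]) v_closure J.

Definition t_ideal I : Prop := ideal I /\ I = t_closure I.

Definition proper_integral_t_ideal I : Prop :=
  [/\ integral_ideal I, I <> baseR & I = t_closure I].

Definition t_maximal M : Prop :=
  proper_integral_t_ideal M /\
  forall J, proper_integral_t_ideal J -> M `<=` J -> J = M.

Definition localization M : set K :=
  [set x | exists a s : R, ~ M s%:F /\ x = a%:F / s%:F].

Definition w_closure I : set K :=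
  \bigcap_(M in t_maximal) prodI I (localization M).

Definition w_ideal I : Prop := ideal I /\ I = w_closure I.

Definition prime_ideal P : Prop :=
  [/\ integral_ideal P, P <> baseR &
      forall a b : R, P (a * b)%:F -> P a%:F \/ P b%:F].

Definition prime_t_ideal P : Prop := prime_ideal P /\ t_ideal P.

(** [n] is the length of a chain [(0) < P 0 < ... < P n.-1]; the first
    inclusion is automatic, since ideals are nonzero. *)
Definition prime_t_chain (n : nat) : Prop :=
  exists P : nat -> set K,
    (forall i, (i < n)%N -> prime_t_ideal (P i)) /\
    (forall i, (i.+1 < n)%N -> P i `<` P i.+1).

(** The [t]-closures below are always taken with respect to [R], also when
    applied to fractional ideals of the overring [(I^t : I^t)]. *)
Definition clifford_t_regular I : Prop :=
  exists2 J, ideal J & t_closure I = t_closure (prodI (prodI I I) J).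

Definition boole_t_regular I : Prop :=
  exists2 x, x != 0 & t_closure (prodI I I) = scaleI x (t_closure I).

Definition t_endo I : set K := colon (t_closure I) (t_closure I).

Definition t_stable I : Prop :=
  t_closure (prodI (t_closure I) (colon (t_endo I) (t_closure I))) = t_endo I.

Definition strongly_t_stable I : Prop :=
  exists x, t_closure I = scaleI x (t_endo I).

End StarOperations.

Definition strong_mori_domain (R : idomainType) : Prop :=
  forall I : nat -> set {fraction R},
    (forall n, integral_ideal (I n) /\ w_ideal (I n)) ->
    (forall n, I n `<=` I n.+1) ->
    exists N, forall n, (N <= n)%N -> I n = I N.

(** The [t]-dimension is a supremum in [nat] extended with infinity;
    this says that it is finite and equal to [d]. *)
Definition t_dimension_is (R : idomainType) (d : nat) : Prop :=
  supremums [set n : nat | prime_t_chain R n] d.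

Definition clifford_t_regular_domain (R : idomainType) : Prop :=
  forall I : set {fraction R}, ideal I -> clifford_t_regular I.

Definition boole_t_regular_domain (R : idomainType) : Prop :=
  forall I : set {fraction R}, ideal I -> boole_t_regular I.

Definition t_stable_domain (R : idomainType) : Prop :=
  forall I : set {fraction R}, ideal I -> t_stable I.

Definition strongly_t_stable_domain (R : idomainType) : Prop :=
  forall I : set {fraction R}, ideal I -> strongly_t_stable I.

(* Main.v *)
Require Import Defs.
From mathcomp Require Import generic_quotient ring.

(** In a strong Mori domain [t = v], divisorial fractional ideals are
    [w]-closed, and every family of [w]-closed submodules of a fractional
    overring [E] has a maximal member.  The two substantial implications use
    associated primes: a maximal colon [(A :_E b)] avoiding a multiplicative
    set is prime.

    (i) => (ii): let [A = I^v], [E = (A : A)] and [L = (A (E : A))^v].  Clifford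
    regularity of [I] gives [(E : L) = E].  If [L <> E], then [L] lies in a
    divisorial prime [N] of [E], which contracts to a [t]-maximal [M] by the
    dimension hypothesis.  For [0 <> c] in [M] some [Q = (cE :_E b)] is a prime
    inside [N] with the same contraction.  Elements of [E] are integral over
    [R_M], hence [Q = N] by incomparability, and [b / c] lies in
    [(E : N) = E], so that [1] is in [Q]: a contradiction.

    (iii) => (i): let [M] be [t]-maximal and [t]-stable, [E = (M : M)].  The same
    argument with [(M :_E b)] in place of [(cE :_E b)] shows that [M (E : M)]
    meets [R \ M].  So [M] is locally invertible in [E], and a form of Krull's
    principal ideal theorem shows that no nonzero prime lies strictly
    below [M].

    Boole regular and [t]-stable give strongly [t]-stable, because
    [(I^2)^v = x I^v] forces [I^v = x E]. *)

Import GRing.Theory.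

Local Notation "a %:F" := (@FracField.tofrac _ a).

(** * Fractional ideals and divisorial closure *)

Section Closures.
Set Implicit Arguments.
Unset Strict Implicit.
Unset Printing Implicit Defensive.
Variable R : idomainType.
Local Notation K := {fraction R}.
Implicit Types (A B C D E I J L M N P Q X : set K) (x y z : K) (a r s : R).

Local Open Scope quotient_scope.

Lemma fraction_denom x : exists2 d : R, d != 0 & baseR (d%:F * x).
Proof.
elim/quotW: x => y.
have tofrac_pi (a : R) : a%:F = \pi_(FracField.type R) (Ratio a 1).
  by rewrite /FracField.tofrac; unlock.
exists \d_y; first exact: denom_ratioP.
exists \n_y => //.
rewrite -[_ * _]/(FracField.mul _ _) !tofrac_pi -FracField.pi_mul.
apply/eqP; rewrite FracField.equivf_def /= /FracField.equivf /FracField.mulf.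
by rewrite !numden_Ratio ?mulr1 ?mul1r ?oner_eq0 ?denom_ratioP // mulrC.
Qed.

Local Close Scope quotient_scope.

Lemma tofrac_neq0 a : a != 0 -> a%:F != 0.
Proof. by rewrite tofrac_eq0. Qed.

Lemma submoduleN A x : submodule A -> A x -> A (- x).
Proof. by move=> [_ _ AZ] /(AZ (-1)); rewrite tofracN tofrac1 mulN1r. Qed.

Lemma submoduleB A x y : submodule A -> A x -> A y -> A (x - y).
Proof. by move=> sA Ax Ay; case: (sA) => _ AD _; apply: AD => //; exact: submoduleN. Qed.

Lemma submoduleI A B : submodule A -> submodule B -> submodule (A `&` B).
Proof.
move=> [A0 AD AZ] [B0 BD BZ]; split; first by split.
- by move=> x y [Ax Bx] [Ay By]; split; [apply: AD|apply: BD].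
- by move=> a x [Ax Bx]; split; [apply: AZ|apply: BZ].
Qed.

Lemma submodule_preim x A : submodule A -> submodule [set y | A (x * y)].
Proof.
move=> [A0 AD AZ]; split=> /= [|y z Ay Az|a y Ay]; first by rewrite mulr0.
- by rewrite mulrDr; exact: AD.
- by rewrite mulrCA; exact: AZ.
Qed.

Lemma submodule_sum A n (f : 'I_n -> K) :
  submodule A -> (forall i, A (f i)) -> A (\sum_(i < n) f i).
Proof. by move=> [A0 AD _] Af; elim/big_ind: _. Qed.

Lemma baseR_submodule : submodule (@baseR R).
Proof.
split; first by exists 0 => //; exact: tofrac0.
- by move=> _ _ [a _ <-] [b _ <-]; exists (a + b) => //; exact: tofracD.
- by move=> a _ [b _ <-]; exists (a * b) => //; exact: tofracM.
Qed.

Lemma baseR_tofrac a : baseR a%:F.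
Proof. by exists a. Qed.

Lemma baseR1 : @baseR R 1.
Proof. by exists 1 => //; exact: tofrac1. Qed.

Lemma baseRM x y : @baseR R x -> @baseR R y -> baseR (x * y).
Proof. by move=> [a _ <-] [b _ <-]; exists (a * b) => //; exact: tofracM. Qed.

Lemma baseR_ideal : ideal (@baseR R).
Proof.
split; first exact: baseR_submodule.
- by exists 1; [exact: baseR1|exact: oner_neq0].
- by exists 1; [exact: oner_neq0|move=> x; rewrite tofrac1 mul1r].
Qed.

Lemma ideal_submodule I : ideal I -> submodule I.
Proof. by case. Qed.

Lemma ideal_subset I J x :
  submodule I -> I x -> x != 0 -> I `<=` J -> ideal J -> ideal I.
Proof.
move=> sI Ix x0 IJ [_ _ [d d0 dJ]]; split=> //; first by exists x.
by exists d => // y /IJ; exact: dJ.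
Qed.

Lemma ideal_meets_baseR I : ideal I -> exists2 c : R, c != 0 & I c%:F.
Proof.
move=> [[_ _ IZ] [x Ix x0] _]; have [d d0 [c _ cE]] := fraction_denom x.
exists c; last by rewrite cE; exact: IZ.
by rewrite -tofrac_eq0 cE mulf_neq0 // tofrac_neq0.
Qed.

Lemma colon_submodule J I : submodule J -> submodule (colon J I).
Proof.
move=> [J0 JD JZ]; split.
- by move=> y _; rewrite mul0r.
- by move=> x x' Jx Jx' y Iy; rewrite mulrDl; apply: JD; [apply: Jx|apply: Jx'].
- by move=> a x Jx y Iy; rewrite -mulrA; apply/JZ/Jx.
Qed.

Lemma colon_ideal J I : ideal J -> ideal I -> ideal (colon J I).
Proof.
move=> [sJ [j Jj j0] [d d0 dJ]] iI.
have [_ _ [e e0 eI]] := iI; have [c c0 Ic] := ideal_meets_baseR iI.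
split; first exact: colon_submodule.
- exists (e%:F * j); last by rewrite mulf_neq0 // tofrac_neq0.
  move=> y /eI [b _ bE]; have -> : e%:F * j * y = b%:F * j by rewrite bE; ring.
  by case: sJ => _ _ JZ; exact: JZ.
- exists (d * c); first by rewrite mulf_neq0.
  move=> x /(_ _ Ic) /dJ; congr baseR; rewrite tofracM; ring.
Qed.

Lemma prodI_mul I J x y : I x -> J y -> prodI I J (x * y).
Proof. by move=> Ix Jy; exists 1%N, (fun=> x), (fun=> y); rewrite big_ord1. Qed.

Lemma prodI_min I J A : A 0 -> (forall x y, A x -> A y -> A (x + y)) ->
  (forall x y, I x -> J y -> A (x * y)) -> prodI I J `<=` A.
Proof.
move=> A0 AD AM _ [n [f [g [fg ->]]]].
by elim/big_ind: _ => // i _; have [If Jg] := fg i; exact: AM.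
Qed.

Lemma prodI_sub I J A : submodule A ->
  (forall x y, I x -> J y -> A (x * y)) -> prodI I J `<=` A.
Proof. by move=> [A0 AD _]; exact: prodI_min. Qed.

Lemma prodI_submodule I J : submodule I -> submodule (prodI I J).
Proof.
move=> [I0 ID IZ]; split.
- by exists 0%N, (fun=> 0), (fun=> 0); split=> [[]//|]; rewrite big_ord0.
- move=> _ _ [n [f [g [fg ->]]]] [m [f' [g' [fg' ->]]]].
  pose h (T : Type) (u : 'I_n -> T) (v : 'I_m -> T) (i : 'I_(n + m)) :=
    match fintype.split i with inl j => u j | inr j => v j end.
  exists (n + m)%N, (h _ f f'), (h _ g g'); split.
    by move=> i; rewrite /h; case: (fintype.split i).
  rewrite big_split_ord /=; congr (_ + _); apply: eq_bigr => i _; rewrite /h.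
    by case: split_ordP => j /eqP; rewrite ?eq_lshift ?eq_lrshift// => /eqP ->.
  by case: split_ordP => j /eqP; rewrite ?eq_rshift ?eq_rlshift// => /eqP ->.
- move=> a _ [n [f [g [fg ->]]]]; exists n, (fun i => a%:F * f i), g; split.
    by move=> i; have [If Jg] := fg i; split=> //; exact: IZ.
  by rewrite mulr_sumr; apply: eq_bigr => i _; rewrite mulrA.
Qed.

Lemma prodI_ideal I J : ideal I -> ideal J -> ideal (prodI I J).
Proof.
move=> [sI [x Ix x0] [d d0 dI]] [sJ [y Jy y0] [e e0 eJ]].
split; first exact: prodI_submodule.
- by exists (x * y); [exact: prodI_mul|rewrite mulf_neq0].
- exists (d * e); first by rewrite mulf_neq0.
  apply: prodI_sub (submodule_preim (d * e)%:F baseR_submodule) _.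
  move=> {Ix x0 Jy y0}x {}y Ix Jy /=.
  have -> : (d * e)%:F * (x * y) = (d%:F * x) * (e%:F * y).
    by rewrite tofracM; ring.
  by apply: baseRM; [exact: dI|exact: eJ].
Qed.

Lemma scaleI_submodule x I : submodule I -> submodule (scaleI x I).
Proof.
move=> [I0 ID IZ]; split; first by exists 0; rewrite ?mulr0.
- by move=> _ _ [y Iy <-] [z Iz <-]; exists (y + z); [exact: ID|rewrite mulrDr].
- by move=> a _ [y Iy <-]; exists (a%:F * y); [exact: IZ|rewrite mulrCA].
Qed.

Lemma scaleI_ideal x I : x != 0 -> ideal I -> ideal (scaleI x I).
Proof.
move=> x0 [sI [y Iy y0] [d d0 dI]]; split; first exact: scaleI_submodule.
- by exists (x * y); [exists y|rewrite mulf_neq0].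
- have [e e0 ex] := fraction_denom x.
  exists (e * d); first by rewrite mulf_neq0.
  move=> _ [z Iz <-]; have -> : (e * d)%:F * (x * z) = (e%:F * x) * (d%:F * z).
    by rewrite tofracM; ring.
  by apply: baseRM => //; exact: dI.
Qed.

Lemma scaleIP x I y : x != 0 -> scaleI x I y <-> I (x^-1 * y).
Proof.
move=> x0; split=> [[z Iz <-]|Iy]; first by rewrite mulKf.
by exists (x^-1 * y) => //; rewrite mulVKf.
Qed.

Lemma sub_v_closure I : I `<=` v_closure I.
Proof. by move=> x Ix y yI; rewrite mulrC; exact: yI. Qed.

Lemma v_closureS I J : I `<=` J -> v_closure I `<=` v_closure J.
Proof. by move=> IJ x xI y yJ; apply: xI => z /IJ; exact: yJ. Qed.

Lemma v_closure_submodule I : submodule (v_closure I).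
Proof. exact: colon_submodule baseR_submodule. Qed.

(** Only the nontrivial inclusion is recorded, for arbitrary subsets of [K]; the other one is
    [sub_v_closure]. *)
Definition v_closed I := v_closure I `<=` I.

(** If [z] is in [(R : A)], then [z x] is in [(R : X)], so [y] multiplies it into [R]. Applied
    repeatedly, this lets the factors of a product pass one at a time from generators to their
    divisorial closure. *)
Lemma v_closure_mul_sub X A x : v_closed A ->
  (forall y, X y -> A (x * y)) -> forall y, v_closure X y -> A (x * y).
Proof.
move=> vA XA y yX; apply: vA => z zA.
have -> : x * y * z = y * (z * x) by ring.
by apply: yX => t Xt; rewrite -mulrA; apply/zA/XA.
Qed.

Lemma v_closure_sub X A : v_closed A -> X `<=` A -> v_closure X `<=` A.
Proof.
move=> vA XA y /(@v_closure_mul_sub X A 1 vA).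
by rewrite mul1r; apply=> z /XA; rewrite mul1r.
Qed.

Lemma v_closure_v_closed X : v_closed (v_closure X).
Proof.
by move=> x xX y yX; apply: xX => z /(_ y yX); rewrite mulrC.
Qed.

Lemma baseR_v_closed : v_closed (@baseR R).
Proof.
move=> x /(_ 1); rewrite mulr1; apply=> y [b _ <-].
by rewrite mul1r; exact: baseR_tofrac.
Qed.

Lemma colon_v_closed J I : v_closed J -> v_closed (colon J I).
Proof.
move=> vJ x xv y Iy; rewrite mulrC; move: x xv.
by apply: v_closure_mul_sub => // z zI; rewrite mulrC; exact: zI.
Qed.

Lemma setI_v_closed A B : v_closed A -> v_closed B -> v_closed (A `&` B).
Proof.
move=> vA vB x xv; split; [apply: vA|apply: vB]; move: x xv;
  apply: v_closureS => x [] //.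
Qed.

Lemma scaleI_v_closed x I : x != 0 -> v_closed I -> v_closed (scaleI x I).
Proof.
move=> x0 vI y yv; apply/scaleIP => //; move: y yv.
by apply: v_closure_mul_sub => // y /scaleIP; exact.
Qed.

Lemma v_closure_ideal I : ideal I -> ideal (v_closure I).
Proof.
move=> iI; have [_ [x Ix x0] _] := iI.
have := colon_ideal baseR_ideal (colon_ideal baseR_ideal iI); exact.
Qed.

Lemma t_closure_sub_v I : t_closure I `<=` v_closure I.
Proof. by move=> x [J [_ JI]]; exact: v_closureS. Qed.

Lemma span_submodule n (g : 'I_n -> K) : submodule (span g).
Proof.
split.
- by exists (fun=> 0); rewrite big1 // => i _; rewrite tofrac0 mul0r.
- move=> _ _ [a ->] [b ->]; exists (fun i => a i + b i).
  by rewrite -big_split; apply: eq_bigr => i _; rewrite tofracD mulrDl.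
- move=> c _ [a ->]; exists (fun i => c * a i).
  by rewrite mulr_sumr; apply: eq_bigr => i _; rewrite tofracM mulrA.
Qed.

Lemma span_gen n (g : 'I_n -> K) i : span g (g i).
Proof.
exists (fun j => (j == i)%:R); rewrite (bigD1 i) //= eqxx tofrac1 mul1r.
by rewrite big1 ?addr0 // => j /negPf ->; rewrite tofrac0 mul0r.
Qed.

Lemma span_sub n (g : 'I_n -> K) A :
  submodule A -> (forall i, A (g i)) -> span g `<=` A.
Proof.
move=> sA Ag _ [a ->]; apply: submodule_sum => // i.
by case: sA => _ _; apply.
Qed.

Lemma span1_ideal x : x != 0 -> ideal (span (fun _ : 'I_1 => x)).
Proof.
move=> x0; split; first exact: span_submodule.
- by exists x => //; exact: (span_gen (fun _ : 'I_1 => x) ord0).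
- have [d d0 dx] := fraction_denom x; exists d => // _ [a ->].
  by rewrite big_ord1 mulrCA; have [_ _] := baseR_submodule; apply.
Qed.

Lemma span1_fg x : x != 0 -> fg_ideal (span (fun _ : 'I_1 => x)).
Proof.
by move=> x0; split; [exact: span1_ideal|exists 1%N, (fun=> x)].
Qed.

Lemma sub_t_closure I : ideal I -> I `<=` t_closure I.
Proof.
move=> iI; have [sI [y Iy y0] _] := iI.
suff tI z : I z -> z != 0 -> t_closure I z.
  (* The span of [0] is not an ideal, so [0] is found in the closure of a nonzero principal one. *)
  move=> x Ix; have [->|] := eqVneq x 0; last exact: tI.
  exists (span (fun _ : 'I_1 => y)); last by have [] := v_closure_submodule
    (span (fun _ : 'I_1 => y)).
  by split; [exact: span1_fg|exact: span_sub].
move=> Iz z0; exists (span (fun _ : 'I_1 => z)).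
  by split; [exact: span1_fg|exact: span_sub].
exact/sub_v_closure/(span_gen (fun _ : 'I_1 => z) ord0).
Qed.

Lemma v_closed_t_closure I : ideal I -> v_closed I -> t_closure I = I.
Proof.
move=> iI vI; apply/seteqP; split; last exact: sub_t_closure.
by move=> x /t_closure_sub_v/vI.
Qed.

End Closures.

(** * Existence of [t]-maximal ideals *)

Section TMaximal.
Set Implicit Arguments.
Unset Strict Implicit.
Unset Printing Implicit Defensive.
Variable R : idomainType.
Local Notation K := {fraction R}.
Implicit Types (A B C D E I J L M N P Q X : set K) (x y z : K) (a r s : R).

Lemma integral_idealE A : submodule A -> A 1 -> A `<=` @baseR R -> A = @baseR R.
Proof.
move=> [_ _ AZ] A1 AR; apply/seteqP; split=> // _ [a _ <-].
by rewrite -[a%:F]mulr1; exact: AZ.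
Qed.

Lemma proper_not1 A : integral_ideal A -> A <> @baseR R -> ~ A 1.
Proof. by move=> [[sA _ _] AR] Aneq A1; apply/Aneq/integral_idealE. Qed.

(** Puts a finitely generated ideal inside the union of a chain into one member; [X0] serves [n = 0]
    and keeps that member nonempty. *)
Lemma total_on_finite (T : Type) (F : set (set T)) (X0 : set T) n
    (g : 'I_n -> T) : total_on F subset -> F X0 ->
  (forall i, exists2 X : set T, F X & X (g i)) ->
  exists X : set T, [/\ F X, X0 `<=` X & forall i, X (g i)].
Proof.
move=> totF FX0; elim: n g => [|n IH] g gF; first by exists X0; split=> // -[].
have [X [FX X0X Xg]] := IH (fun i => g (lift ord0 i)) (fun i => gF _).
have [Y FY Yg] := gF ord0; have [XY|YX] := totF _ _ FX FY.
  exists Y; split=> //; first exact: subset_trans XY.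
  by move=> i; case: (unliftP ord0 i) => [j|] ->; [exact: XY|].
exists X; split=> // i; case: (unliftP ord0 i) => [j|] -> //; exact: YX.
Qed.

Lemma exists_t_maximal A : proper_integral_t_ideal A ->
  exists2 M, t_maximal M & A `<=` M.
Proof.
move=> pA; have [[iA _] _ _] := pA; have [sA [a0 Aa0 a0n0] _] := iA.
(* Zorn's lemma also tests the empty chain, whose union is empty; hence the first alternative,
   discarded at the end because [A] is nonempty. *)
pose P B := B = set0 \/ (proper_integral_t_ideal B /\ A `<=` B).
have [F FP totF|M [PM maxM]] := @Zorn_bigcup K P.
  have [[X0 FX0 [X00 AX0]]|noX] :=
      pselect (exists2 X, F X & proper_integral_t_ideal X /\ A `<=` X); last first.
    left; apply/seteqP; split=> // x [X FX Xx].
    have [X0|pX] := FP _ FX; first by rewrite X0 in Xx.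
    by apply: noX; exists X.
  have FX X x : F X -> X x -> proper_integral_t_ideal X.
    by move=> FX Xx; case: (FP _ FX) => [X_0|[]//]; rewrite X_0 in Xx.
  have AU : A `<=` \bigcup_(X in F) X by move=> x /AX0; exists X0.
  have UR : \bigcup_(X in F) X `<=` @baseR R.
    by move=> x [X FX' Xx]; have [[_ XR] _ _] := FX _ _ FX' Xx; exact: XR.
  have sU : submodule (\bigcup_(X in F) X).
    split; first by exists X0 => //; have [[[[]]]] := X00.
    - move=> x y [X FX' Xx] [Y FY Yy].
      have [XY|YX] := totF _ _ FX' FY; [exists Y|exists X] => //.
        have [[[[_ YD _] _ _] _] _ _] := FX _ _ FY Yy; exact: YD (XY _ Xx) Yy.
      have [[[[_ XD _] _ _] _] _ _] := FX _ _ FX' Xx; exact: XD Xx (YX _ Yy).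
    - move=> a x [X FX' Xx]; exists X => //.
      by have [[[[_ _ XZ] _ _] _] _ _] := FX _ _ FX' Xx; exact: XZ.
  have iU : integral_ideal (\bigcup_(X in F) X).
    split=> //; split=> //; first by exists a0 => //; exact: AU.
    by exists 1; [exact: oner_neq0|move=> x /UR; rewrite tofrac1 mul1r].
  right; split=> //; split=> //.
    move=> UE; have [X FX' X1] : (\bigcup_(X in F) X) 1.
      by rewrite UE; exact: baseR1.
    by have [iX XR _] := FX _ _ FX' X1; case: (proper_not1 iX XR).
  apply/seteqP; split; first by apply: sub_t_closure; case: iU.
  (* Finite character: the generators of [J] lie in one member [X], so [J^v] is inside [X^t = X]. *)
  move=> x [J [[iJ [n [g JE]]] JU] Jx].
  have [|X [FX' X0X Xg]] := @total_on_finite K F X0 n g totF FX0.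
    move=> i; have /JU[X FX' Xg] : J (g i) by rewrite JE; exact: span_gen.
    by exists X.
  have Xa0 := X0X _ (AX0 _ Aa0).
  exists X => //; have [[[sX _ _] _] _ ->] := FX _ _ FX' Xa0.
  exists J => //; split; last by rewrite JE; exact: span_sub.
  by split=> //; exists n, g.
case: PM => [M0|[pM AM]].
  exfalso; apply: (maxM A); last by right; split.
  by rewrite M0; split; [exact: sub0set|move=> /(_ _ Aa0)].
exists M => //; split=> // J pJ MJ; apply: contrapT => JM.
apply: (maxM J); first split=> // JM'.
  by apply: JM; apply/seteqP.
by right; split=> //; exact: subset_trans MJ.
Qed.

End TMaximal.

(** * The [w]-closure and chain conditions *)

Section WClosure.
Set Implicit Arguments.
Unset Strict Implicit.
Unset Printing Implicit Defensive.
Variable R : idomainType.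
Local Notation K := {fraction R}.
Implicit Types (A B C D E I J L M N P Q X : set K) (x y z : K) (a r s : R).

Lemma scaleI_span x n (g : 'I_n -> K) :
  scaleI x (span g) = span (fun i => x * g i).
Proof.
apply/seteqP; split=> [_ [_ [a ->] <-]|_ [a ->]].
  by exists a; rewrite mulr_sumr; apply: eq_bigr => i _; rewrite mulrCA.
exists (\sum_(i < n) (a i)%:F * g i); first by exists a.
by rewrite mulr_sumr; apply: eq_bigr => i _; rewrite mulrCA.
Qed.

(** A finitely generated [J] inside the preimage gives a finitely generated [x J] inside [M], and
    [x J^v] lies in [(x J)^v]. *)
Lemma t_closed_preim M x : t_closure M `<=` M -> x != 0 ->
  t_closure (@baseR R `&` [set z | M (x * z)]) `<=` [set z | M (x * z)].
Proof.
move=> tM x0 z [J [[iJ [n [g JE]]] JM] Jz] /=.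
have xJM : scaleI x J `<=` M by move=> _ [y /JM[_ My] <-].
apply: tM; exists (scaleI x J).
  split=> //; split; first exact: scaleI_ideal.
  by exists n, (fun i => x * g i); rewrite JE scaleI_span.
move: z Jz; apply: v_closure_mul_sub; first exact: v_closure_v_closed.
by move=> y Jy; apply: sub_v_closure; exists y.
Qed.

Lemma t_maximal_sub_baseR M : t_maximal M -> M `<=` @baseR R.
Proof. by move=> [[[]]]. Qed.

Lemma t_maximal_ideal M : t_maximal M -> ideal M.
Proof. by move=> [[[]]]. Qed.

Lemma t_maximal_not1 M : t_maximal M -> ~ M 1.
Proof. by move=> [[iM MR _] _]; exact: proper_not1. Qed.

Lemma t_maximal_not1F M : t_maximal M -> ~ M (1 : R)%:F.
Proof. by rewrite tofrac1; exact: t_maximal_not1. Qed.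

(** For [a] in [R] outside [M], [B = (M :_R a)] is a proper [t]-ideal containing [M], hence equal to
    [M]. *)
Lemma t_maximal_prime M : t_maximal M -> prime_ideal M.
Proof.
move=> tM; have [[[iM MR] Mneq Mt] maxM] := tM.
split=> // a b Mab; have [Ma|Ma] := pselect (M a%:F); first by left.
right; have a0 : a%:F != 0.
  by apply/eqP => a0; apply: Ma; rewrite a0; case: iM => [[]].
pose B := @baseR R `&` [set z | M (a%:F * z)].
have MB : M `<=` B.
  by move=> z Mz; split; [exact: MR|case: iM => [[_ _ MZ] _ _]; exact: MZ].
have [sM [m Mm m0] _] := iM.
have iB : ideal B.
  apply: (@ideal_subset _ _ (@baseR R) m) => //.
  - by apply: submoduleI; [exact: baseR_submodule|exact: submodule_preim].
  - exact: MB.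
  - by move=> ? [].
  - exact: baseR_ideal.
have <- : B = M.
  apply: maxM => //; split; first by split=> // ? [].
  - move=> BR; apply: Ma; rewrite -[a%:F]mulr1.
    by have [] : B 1 by rewrite BR; exact: baseR1.
  - apply/seteqP; split; first exact: sub_t_closure.
    move=> z Bz; split; last by apply: t_closed_preim Bz => //; rewrite -Mt.
    apply: (@v_closure_sub _ B) (t_closure_sub_v Bz) => [|? []//].
    exact: baseR_v_closed.
by split; [exact: baseR_tofrac|rewrite /= -tofracM].
Qed.

Lemma t_maximal_mul M a b : t_maximal M ->
  ~ M a%:F -> ~ M b%:F -> ~ M (a * b)%:F.
Proof. by move=> /t_maximal_prime[_ _ +] Ma Mb Mab => /(_ _ _ Mab)[]. Qed.

(** The intersection of the localizations [A_M], with denominators cleared by hand;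
    [w_closed_w_ideal] links it to [w_closure]. *)
Definition w_hull A : set K :=
  [set x | forall M, t_maximal M -> exists2 s : R, ~ M s%:F & A (s%:F * x)].

Definition w_closed A := w_hull A `<=` A.

(** For [x] in every [R_M], the divisorial ideal [B] of denominators of [x] lies in no [t]-maximal
    ideal, so it contains [1]. *)
Lemma baseR_w_closed : w_closed (@baseR R).
Proof.
move=> x xw; pose B := @baseR R `&` [set z | baseR (x * z)].
have vB : v_closed B.
  apply: setI_v_closed; first exact: baseR_v_closed.
  move=> z Bz /=; move: z Bz; apply: v_closure_mul_sub => //.
  exact: baseR_v_closed.
suff [_] : B 1 by rewrite /= mulr1.
apply: contrapT => B1; have iB : ideal B.
  have [d d0 dx] := fraction_denom x.
  apply: (@ideal_subset _ _ (@baseR R) d%:F).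
  - by apply: submoduleI; [|apply: submodule_preim]; exact: baseR_submodule.
  - by split; [exact: baseR_tofrac|rewrite /= mulrC].
  - exact: tofrac_neq0.
  - by move=> ? [].
  - exact: baseR_ideal.
have [|M tM BM] := @exists_t_maximal _ B.
  split; first by split=> // ? [].
  - by move=> BR; apply: B1; rewrite BR; exact: baseR1.
  - by rewrite v_closed_t_closure.
have [s Ms sx] := xw M tM; apply/Ms/BM; split; first exact: baseR_tofrac.
by rewrite /= mulrC.
Qed.

(** A divisorial module is cut out by conditions [x y] in [R], each of which can be tested at the
    [t]-maximal ideals. *)
Lemma v_closed_w_closed A : v_closed A -> w_closed A.
Proof.
move=> vA x xw; apply: vA => y yA; apply: baseR_w_closed => M /xw[s Ms sx].
exists s => //; have -> : s%:F * (x * y) = y * (s%:F * x) by ring.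
exact: yA.
Qed.

Lemma sub_w_hull A : submodule A -> A `<=` w_hull A.
Proof.
move=> [_ _ AZ] x Ax M tM; exists 1; first exact: t_maximal_not1F.
exact: AZ.
Qed.

Lemma w_hullS A B : A `<=` B -> w_hull A `<=` w_hull B.
Proof. by move=> AB x xA M /xA[s Ms sx]; exists s => //; exact: AB. Qed.

Lemma w_hull_w_closed A : w_closed (w_hull A).
Proof.
move=> x xw M tM; have [s Ms /(_ M tM)[s' Ms' ssx]] := xw M tM.
by exists (s' * s); [exact: t_maximal_mul|rewrite tofracM -mulrA].
Qed.

Lemma w_hull_submodule A : submodule A -> submodule (w_hull A).
Proof.
move=> sA; have [A0 AD AZ] := sA; split; first exact: sub_w_hull.
- move=> x y xw yw M tM; have [s Ms sx] := xw M tM; have [r Mr ry] := yw M tM.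
  exists (r * s); first exact: t_maximal_mul.
  have -> : (r * s)%:F * (x + y) = r%:F * (s%:F * x) + s%:F * (r%:F * y).
    by rewrite tofracM; ring.
  by apply: AD; exact: AZ.
- move=> a x xw M tM; have [s Ms sx] := xw M tM.
  by exists s => //; rewrite mulrCA; exact: AZ.
Qed.

Lemma w_closed_w_ideal A : ideal A -> w_closed A -> w_ideal A.
Proof.
move=> iA wA; have [sA _ _] := iA; have [A0 AD AZ] := sA; split=> //.
apply/seteqP; split=> [x Ax M tM|x xw].
  rewrite -[x]mulr1; apply: prodI_mul => //; exists 1, 1.
  by split; [exact: t_maximal_not1F|rewrite tofrac1 divr1].
apply: wA => M tM.
(* A finite sum in [A R_M] has a common denominator outside [M]. *)
suff: [set x | exists2 s : R, ~ M s%:F & A (s%:F * x)] x by [].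
apply: prodI_min (xw M tM) => /=.
- by exists 1; [exact: t_maximal_not1F|rewrite mulr0].
- move=> y z [s Ms sy] [r Mr rz].
  exists (r * s); first exact: t_maximal_mul.
  have -> : (r * s)%:F * (y + z) = r%:F * (s%:F * y) + s%:F * (r%:F * z).
    by rewrite tofracM; ring.
  by apply: AD; exact: AZ.
- move=> y _ Ay [a [s [Ms ->]]]; exists s => //.
  have s0 : s%:F != 0 by apply/eqP => s0; apply: Ms; rewrite s0;
    case: (t_maximal_ideal tM) => [[]].
  have -> : s%:F * (y * (a%:F / s%:F)) = s%:F * (s%:F^-1 * (a%:F * y)) by ring.
  by rewrite mulVKf //; exact: AZ.
Qed.

Lemma scaleI_w_closed x A : x != 0 -> w_closed A -> w_closed (scaleI x A).
Proof.
move=> x0 wA y yw; apply/scaleIP => //; apply: wA => M /yw[s Ms].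
by move=> /(scaleIP _ _ x0) H; exists s => //; rewrite mulrCA.
Qed.

(** * Consequences of the ascending chain condition on [w]-ideals *)

Section StrongMori.
Hypothesis R_strong_mori : strong_mori_domain R.

(** Without a maximal member, choice builds a strictly increasing sequence in [F]; a common
    denominator [d] of [E] turns it into a chain of integral [w]-ideals. *)
Lemma w_closed_maximal E (F : set (set K)) : ideal E -> F !=set0 ->
  (forall A, F A -> [/\ ideal A, w_closed A & A `<=` E]) ->
  exists2 A, F A & forall B, F B -> A `<=` B -> B `<=` A.
Proof.
move=> [_ _ [d d0 dE]] [A0 FA0] FE; apply: contrapT => noMax.
have step (A : {A | F A}) :
    exists B : {A | F A}, sval A `<=` sval B /\ ~ sval B `<=` sval A.
  apply: contrapT => noB; apply: noMax; exists (sval A); first exact: svalP.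
  move=> B FB AB; apply: contrapT => BA.
  by apply: noB; exists (exist _ B FB).
have [f fP] := choice step.
pose I n := sval (iter n f (exist _ A0 FA0)).
have d0' := tofrac_neq0 d0.
have FI n : F (I n) by exact: svalP.
have [|n|N IN] := R_strong_mori (I := fun n => scaleI d%:F (I n)).
- move=> n; have [iI wI IE] := FE _ (FI n).
  have idI := scaleI_ideal d0' iI.
  split; first by split=> // _ [x /IE/dE + <-].
  exact/w_closed_w_ideal/scaleI_w_closed.
- by move=> _ [x Ix <-]; exists x => //; apply: (fP _).1.
apply: (fP (iter N f (exist _ A0 FA0))).2 => x Ix.
have [y Iy /(mulfI d0') <- //] : scaleI d%:F (I N) (d%:F * x).
by rewrite -(IN N.+1) //; exists x.
Qed.

Lemma fg_ideal_add J x I : fg_ideal J -> J `<=` I -> ideal I -> I x ->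
  exists2 J', fg_ideal J' & [/\ J `<=` J', J' x & J' `<=` I].
Proof.
move=> [iJ [n [g JE]]] JI iI Ix; have [sI _ _] := iI.
pose h (i : 'I_n.+1) := oapp g x (unlift ord0 i).
have hS i : h (lift ord0 i) = g i by rewrite /h liftK.
have JJ : J `<=` span h.
  by rewrite JE; apply: span_sub (span_submodule h) _ => i; rewrite -hS;
    exact: span_gen.
have JI' : span h `<=` I.
  apply: span_sub => // i; case: (unliftP ord0 i) => [j|] ->.
    by rewrite hS; apply: JI; rewrite JE; exact: span_gen.
  by rewrite /h unlift_none.
exists (span h); last first.
  split=> //; have := span_gen h ord0; by rewrite {2}/h unlift_none.
split; last by exists n.+1, h.
have [_ [y Jy y0] _] := iJ.
apply: (@ideal_subset _ _ I y) => //; [exact: span_submodule|exact: JJ].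
Qed.

(** Take [J] with maximal [w_hull J]: adjoining any [x] of [I] to [J] cannot enlarge the hull, so
    [x] is already in it. *)
Lemma fg_w_dense I : ideal I -> exists2 J, fg_ideal J & J `<=` I /\ I `<=` w_hull J.
Proof.
move=> iI; have [sI [y Iy y0] _] := iI.
pose F := [set w_hull J | J in [set J | fg_ideal J /\ J `<=` I]].
have [|A [J [fJ JI] <-]|_ [J [fJ JI] <-] maxJ] :=
    w_closed_maximal (F := F) (v_closure_ideal iI).
- exists (w_hull (span (fun _ : 'I_1 => y))), (span (fun _ : 'I_1 => y)) => //.
  by split; [exact: span1_fg|exact: span_sub].
- have [[sJ [z Jz z0] _] _] := fJ.
  have JI' : w_hull J `<=` v_closure I.
    apply: subset_trans (w_hullS (subset_trans JI (@sub_v_closure _ I))) _.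
    exact: v_closed_w_closed (@v_closure_v_closed _ _).
  split=> //; last exact: w_hull_w_closed.
  apply: (@ideal_subset _ _ (v_closure I) z) => //.
  + exact: w_hull_submodule.
  + exact: sub_w_hull.
  + exact: v_closure_ideal.
exists J => //; split=> // x Ix.
have [J' fJ' [JJ' J'x J'I]] := fg_ideal_add fJ JI iI Ix.
apply: (maxJ (w_hull J')); [by exists J'|exact: w_hullS|].
by apply: sub_w_hull => //; case: fJ' => [[]].
Qed.

(** With [J] from [fg_w_dense], [J^v] is [w]-closed, so it contains [I] and then [I^v]. *)
Lemma t_closureE I : ideal I -> t_closure I = v_closure I.
Proof.
move=> /fg_w_dense[J fJ [JI IJ]]; apply/seteqP; split; first exact: t_closure_sub_v.
move=> x xI; exists J => //; apply: v_closure_sub xI.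
  exact: v_closure_v_closed.
apply: subset_trans IJ _; apply: subset_trans (w_hullS (@sub_v_closure _ J)) _.
exact: v_closed_w_closed (@v_closure_v_closed _ _).
Qed.

End StrongMori.
End WClosure.

(** * Primes of overrings *)

Section Overrings.
Set Implicit Arguments.
Unset Strict Implicit.
Unset Printing Implicit Defensive.
Variable R : idomainType.
Local Notation K := {fraction R}.
Implicit Types (A B C D E I J L M N P Q S X : set K) (b x y z : K) (a r s : R).

Definition emodule E A : Prop :=
  submodule A /\ forall e x, E e -> A x -> A (e * x).

(** Being a fractional ideal of [R], [E] has a common denominator, which makes [w_closed_maximal]
    available inside it. *)
Definition overring E : Prop := [/\ ideal E, w_closed E, E 1 & emodule E E].

Definition prime_of E Q : Prop :=
  [/\ emodule E Q, Q `<=` E, ~ Q 1 &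
      forall x y, E x -> E y -> Q (x * y) -> Q x \/ Q y].

Definition colon_in E A b : set K := [set z | E z /\ A (z * b)].

Lemma colon_overring I : ideal I -> v_closed I -> overring (colon I I).
Proof.
move=> iI vI; have iE := colon_ideal iI iI; split=> //.
- exact: v_closed_w_closed (colon_v_closed vI).
- by move=> y Iy; rewrite mul1r.
- split; first by case: iE.
  by move=> e x Ee Ex y Iy; rewrite -mulrA; apply/Ee/Ex.
Qed.

Lemma overring_tofrac E a : overring E -> E a%:F.
Proof. by move=> [[[_ _ EZ] _ _] _ E1 _]; rewrite -[a%:F]mulr1; exact: EZ. Qed.

Lemma colon_in_emodule E A b :
  overring E -> emodule E A -> emodule E (colon_in E A b).
Proof.
move=> [[sE _ _] _ _ [_ EE]] [sA EA]; split.
  apply: submoduleI => //; have := submodule_preim b sA; congr submodule.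
  by apply/funext => x /=; rewrite mulrC.
by move=> e x Ee [Ex Axb]; split; [exact: EE|rewrite -mulrA; exact: EA].
Qed.

Lemma sub_colon_in E A b : A `<=` E -> emodule E A -> E b -> A `<=` colon_in E A b.
Proof.
by move=> AE [_ EA] Eb x Ax; split; [exact: AE|rewrite mulrC; exact: EA].
Qed.

Lemma emodule_ideal E A B :
  overring E -> ideal A -> emodule E B -> A `<=` B -> B `<=` E -> ideal B.
Proof.
move=> [iE _ _ _] [_ [x Ax x0] _] [sB _] AB BE.
by apply: (@ideal_subset _ _ E x) => //; exact: AB.
Qed.

Lemma colon_in_ideal E A b : overring E -> ideal A -> A `<=` E ->
  emodule E A -> E b -> ideal (colon_in E A b).
Proof.
move=> oE iA AE mA Eb; apply: (emodule_ideal oE iA).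
- exact: colon_in_emodule.
- exact: sub_colon_in.
- by move=> ? [].
Qed.

Lemma colon_in_w_closed E A b :
  w_closed E -> w_closed A -> w_closed (colon_in E A b).
Proof.
move=> wE wA x xw; split; [apply: wE|apply: wA] => M tM;
  have [s Ms [Es As]] := xw M tM; exists s => //.
by rewrite mulrA.
Qed.

Lemma colon_in_v_closed E A b :
  v_closed E -> v_closed A -> v_closed (colon_in E A b).
Proof.
move=> vE vA; apply: setI_v_closed => //= x xv; rewrite /= mulrC.
by move: x xv; apply: v_closure_mul_sub => // y /=; rewrite mulrC.
Qed.

(** Values at [x] of the polynomials over [R] of degree less than [n], in Horner form so that
    induction peels off the constant term. *)
Fixpoint horner_set x n : set K :=
  if n is n'.+1 then
    [set y | exists a : R, exists2 u, horner_set x n' u & y = a%:F + x * u]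
  else [set 0].

Lemma horner_set_submodule x n : submodule (horner_set x n).
Proof.
elim: n => [|n [T0 TD TZ]] /=.
  split=> //= [y z -> ->|a y ->]; [exact: addr0|exact: mulr0].
split.
- by exists 0, 0 => //; rewrite mulr0 tofrac0 addr0.
- move=> _ _ [a [u Tu ->]] [b [v Tv ->]]; exists (a + b), (u + v).
    exact: TD.
  by rewrite tofracD; ring.
- move=> c _ [a [u Tu ->]]; exists (c * a), (c%:F * u); first exact: TZ.
  by rewrite tofracM; ring.
Qed.

Lemma horner_setS x n : horner_set x n `<=` horner_set x n.+1.
Proof.
elim: n => [_ ->|n IH _ [a [u Tu ->]]]; last by exists a, u => //; exact: IH.
by exists 0, 0 => //; rewrite mulr0 tofrac0 addr0.
Qed.

Lemma horner_set_exp x n : horner_set x n.+1 (x ^+ n).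
Proof.
elim: n => [|n IH].
  by exists 1, 0 => //; rewrite mulr0 addr0 tofrac1.
by exists 0, (x ^+ n) => //; rewrite tofrac0 add0r exprS.
Qed.

Lemma horner_set_sub E x n : overring E -> E x -> horner_set x n `<=` E.
Proof.
move=> oE Ex; have [[[E0 ED _] _ _] _ _ [_ EM]] := oE.
elim: n => [_ ->//|n IH _ [a [u Tu ->]]].
by apply: ED; [exact: overring_tofrac|apply: EM => //; exact: IH].
Qed.

Section StrongMori.
Hypothesis R_strong_mori : strong_mori_domain R.

(** Colons of a [w]-closed module are [w]-closed, so one is maximal among those avoiding [S]. The
    choice of [S] locates the prime: [{1}] makes it proper, the complement of a prime [N] keeps it
    inside [N]. *)
Lemma exists_prime_colon E A S : overring E -> ideal A -> w_closed A ->
  emodule E A -> A `<=` E -> S 1 -> S `<=` E ->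
  (forall x y, S x -> S y -> S (x * y)) -> (forall x, S x -> ~ A x) ->
  exists b, [/\ E b, prime_of E (colon_in E A b) &
                forall x, S x -> ~ colon_in E A b x].
Proof.
move=> oE iA wA mA AE S1 SE SM SA; have [iE wE E1 [sE EM]] := oE.
pose F := [set colon_in E A b | b in
  [set b | E b /\ forall x, S x -> ~ colon_in E A b x]].
have [|_ [b [Eb _] <-]|_ [b [Eb Sb] <-] maxb] :=
    w_closed_maximal R_strong_mori (F := F) iE.
- exists (colon_in E A 1); exists 1 => //; split=> // x Sx [_].
  by rewrite mulr1; exact: SA.
- split; [exact: colon_in_ideal|exact: colon_in_w_closed|by move=> ? []].
exists b; split=> //; split=> //.
- exact: colon_in_emodule.
- by move=> ? [].
- exact: Sb.
have maxM y : E y -> (forall x, S x -> ~ colon_in E A (y * b) x) ->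
    colon_in E A (y * b) `<=` colon_in E A b.
  move=> Ey Sy; apply: maxb; first by exists (y * b) => //; split=> //; exact: EM.
  move=> z [Ez Azb]; split=> //.
  by rewrite mulrCA; case: mA => _; apply.
move=> x y Ex Ey [_ Axyb].
(* If [(A :_E x b)] avoids [S], it lies in the maximal colon and contains [y]. Otherwise it contains
   some [s] of [S]; then [(A :_E s b)] still avoids the multiplicative set [S] and contains [x]. *)
have [[s [Ss [_ Asxb]]]|noS] :=
    pselect (exists s : K, S s /\ colon_in E A (x * b) s); last first.
  right; apply: (maxM x) => //; first by move=> s Ss sQ; apply: noS; exists s.
  by split=> //; have -> : y * (x * b) = x * y * b by ring.
left; apply: (maxM s); first exact: SE.
  move=> z Sz [Ez Azsb]; apply: (Sb (z * s)); first exact: SM.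
  by split; [apply: EM => //; exact: SE|rewrite -mulrA].
by split=> //; have -> : x * (s * b) = s * (x * b) by ring.
Qed.

(** The [w]-hulls of the polynomial values of bounded degree increase inside [E]; a maximal one
    already contains the next power of [x]. *)
Lemma local_integral E M x : overring E -> t_maximal M -> E x ->
  exists n, exists2 s : R, ~ M s%:F & horner_set x n (s%:F * x ^+ n).
Proof.
move=> oE tM Ex; have [iE wE E1 [sE EM]] := oE.
pose F := [set w_hull (horner_set x n.+1) | n in setT].
have [|_ [n _ <-]|_ [n _ <-] maxn] :=
    w_closed_maximal R_strong_mori (F := F) iE.
- by exists (w_hull (horner_set x 1)); exists 0%N.
- have sT := horner_set_submodule x n.+1.
  have TE : w_hull (horner_set x n.+1) `<=` E.
    exact: subset_trans (w_hullS (@horner_set_sub _ _ _ oE Ex)) wE.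
  split=> //; last exact: w_hull_w_closed.
  apply: (@ideal_subset _ _ E 1) => //; last exact: oner_neq0.
    exact: w_hull_submodule.
  apply: sub_w_hull => //; exists 1, 0; last by rewrite tofrac1 mulr0 addr0.
  by case: (horner_set_submodule x n).
exists n.+1.
suff /(_ M tM)[s Ms sx] : w_hull (horner_set x n.+1) (x ^+ n.+1) by exists s.
apply: (maxn (w_hull (horner_set x n.+2))); first by exists n.+1.
  exact: w_hullS (@horner_setS _ _).
apply: sub_w_hull; first exact: horner_set_submodule.
exact: horner_set_exp.
Qed.

(** For [x] in [N] outside [Q], take an integral relation modulo [Q]. Its constant term is in [N],
    hence in [M] and in [Q]; as [Q] is prime, a factor [x] cancels and the degree drops. *)
Lemma primes_over_t_maximal_incomparable E M Q N : overring E ->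
  t_maximal M -> prime_of E Q -> prime_of E N -> Q `<=` N -> M `<=` Q ->
  (forall a, N a%:F -> M a%:F) -> N `<=` Q.
Proof.
move=> oE tM pQ pN QN MQ NM x Nx; apply: contrapT => Qx.
have [[sQ EQ] QE Q1 QP] := pQ; have [[sN EN] NE _ _] := pN.
have [[[E0 ED EZ] _ _] _ _ [sE EM]] := oE; have Ex := NE _ Nx.
suff step n s u : ~ M s%:F -> horner_set x n u -> ~ Q (s%:F * x ^+ n - u).
  have [n [s Ms sx]] := local_integral oE tM Ex.
  by apply: (step n s _ Ms sx); rewrite subrr; case: sQ.
move=> Ms; elim: n u => [u ->|n IH _ [a [u Tu ->]] Qsx].
  (* In degree zero [s] itself would lie in [Q], hence in [N] and in [M]. *)
  by rewrite mulr1 subr0 => /QN/NM.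
have Exn : E (x ^+ n).
  by apply: (horner_set_sub oE Ex); exact: horner_set_exp.
have Ey : E (s%:F * x ^+ n - u).
  by apply: submoduleB => //; [exact: EZ|exact: horner_set_sub Tu].
have eqn : s%:F * x ^+ n.+1 - (a%:F + x * u) = (s%:F * x ^+ n - u) * x - a%:F.
  by rewrite exprS; ring.
have Qa : Q a%:F.
  apply/MQ/NM; rewrite -[a%:F](subKr ((s%:F * x ^+ n - u) * x)) -eqn.
  by apply: submoduleB => //; [exact: EN|exact: QN].
have [] // : Q (s%:F * x ^+ n - u) \/ Q x; last exact: IH Tu.
apply: QP => //; rewrite -[_ * x](subrK a%:F) -eqn.
by case: sQ => _ QD _; exact: QD.
Qed.

Lemma contraction_prime_t_ideal E N : overring E -> prime_of E N ->
  ideal N -> v_closed N -> prime_t_ideal (@baseR R `&` N).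
Proof.
move=> oE [_ _ N1 NP] iN vN; have [sN _ _] := iN.
have [c c0 Nc] := ideal_meets_baseR iN.
have iP : ideal (@baseR R `&` N).
  apply: (@ideal_subset _ _ (@baseR R) c%:F).
  - by apply: submoduleI => //; exact: baseR_submodule.
  - by split=> //; exact: baseR_tofrac.
  - exact: tofrac_neq0.
  - by move=> ? [].
  - exact: baseR_ideal.
split; last first.
  split=> //; rewrite v_closed_t_closure //.
  by apply: setI_v_closed => //; exact: baseR_v_closed.
split; first by split=> // ? [].
  move=> PR; apply: N1; suff [] : (@baseR R `&` N) 1 by [].
  by rewrite PR; exact: baseR1.
move=> a b [_]; rewrite tofracM.
move=> /(NP _ _ (overring_tofrac a oE) (overring_tofrac b oE)).
by case=> ?; [left|right]; split=> //; exact: baseR_tofrac.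
Qed.

Lemma prime_t_ideal_sub_t_maximal P : prime_t_ideal P ->
  exists2 M, t_maximal M & P `<=` M.
Proof. by move=> [[iP PR _] [_ Pt]]; exact: exists_t_maximal. Qed.

Lemma t_maximal_prime_t_ideal M : t_maximal M -> prime_t_ideal M.
Proof.
move=> tM; split; first exact: t_maximal_prime.
by split; [exact: t_maximal_ideal|case: tM => [[]]].
Qed.

(** The dimension hypothesis enters as [dim1], which forces the contractions to [R] of both primes
    [N] and [Q] to be the same [t]-maximal [M]. *)
Lemma divisorial_trivial_colon E L : overring E -> v_closed E ->
  (forall P Q, prime_t_ideal P -> prime_t_ideal Q -> P `<=` Q -> Q `<=` P) ->
  ideal L -> v_closed L -> emodule E L -> L `<=` E -> colon E L `<=` E -> L 1.
Proof.
move=> oE vE dim1 iL vL mL LE EL; apply: contrapT => L1.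
have [iE wE E1 [sE EM]] := oE.
have [|||b0 [Eb0 pN _]] :=
    @exists_prime_colon E L [set 1] oE iL (v_closed_w_closed vL) mL LE erefl.
- by move=> _ ->.
- by move=> _ _ -> ->; rewrite /= mulr1.
- by move=> _ ->.
set N := colon_in E L b0 in pN.
have LN : L `<=` N by exact: sub_colon_in.
have iN : ideal N by exact: colon_in_ideal.
have vN : v_closed N by exact: colon_in_v_closed.
have NE : N `<=` E by move=> ? [].
have EN : colon E N `<=` E.
  by move=> x xN; apply: EL => y Ly; apply/xN/LN.
have tP := contraction_prime_t_ideal oE pN iN vN.
have [M tM PM] := prime_t_ideal_sub_t_maximal tP.
have tM' := t_maximal_prime_t_ideal tM.
have MP := dim1 _ _ tP tM' PM.
have NM a : N a%:F -> M a%:F.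
  by move=> Na; apply: PM; split=> //; exact: baseR_tofrac.
have [c c0 Mc] := ideal_meets_baseR (t_maximal_ideal tM).
have c0' := tofrac_neq0 c0.
have [_ Nc] := MP _ Mc.
pose A := scaleI c%:F E.
have iA : ideal A by exact: scaleI_ideal.
have mA : emodule E A.
  split; first by case: iA.
  by move=> e _ Ee [x Ex <-]; exists (e * x); [exact: EM|rewrite mulrCA].
have AN : A `<=` N.
  by move=> _ [x Ex <-]; rewrite mulrC; case: pN => [[_ +] _ _ _]; apply.
have vA : v_closed A by exact: scaleI_v_closed.
have AE := subset_trans AN NE.
have [|||x [Ex Nx]|b [Eb pQ QS]] := @exists_prime_colon E A
    [set x | E x /\ ~ N x] oE iA (v_closed_w_closed vA) mA AE.
- by split=> //; case: pN.
- by move=> ? [].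
- move=> x y [Ex Nx] [Ey Ny]; split; first exact: EM.
  by case: pN => _ _ _ pN /(pN _ _ Ex Ey)[].
- by move=> /AN.
set Q := colon_in E A b in pQ QS.
have QN : Q `<=` N by move=> x Qx; apply: contrapT => Nx; apply: (QS x) => //;
  split=> //; case: Qx.
have iQ : ideal Q by exact: colon_in_ideal.
have vQ : v_closed Q by exact: colon_in_v_closed.
have tQ := contraction_prime_t_ideal oE pQ iQ vQ.
have MQ : M `<=` Q.
  apply: subset_trans (dim1 _ _ tQ tM' _) _; last by move=> ? [].
  by move=> x [Rx /QN Nx]; exact: PM.
have NQ := primes_over_t_maximal_incomparable oE tM pQ pN QN MQ NM.
(* Since [N] is inside [Q], [c^-1 b] multiplies [N] into [E] and so lies in [E]; hence [b] is in
   [c E] and [1] in [Q]. *)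
have [_ _ Q1 _] := pQ; apply: Q1; split=> //; rewrite mul1r.
exists (c%:F^-1 * b); last by rewrite mulVKf.
apply: EN => x /NQ[_ /(scaleIP _ _ c0')].
by rewrite mulrA mulrAC.
Qed.

End StrongMori.
End Overrings.

(** * Stable [t]-maximal ideals *)

Section Dimension.
Set Implicit Arguments.
Unset Strict Implicit.
Unset Printing Implicit Defensive.
Variable R : idomainType.
Local Notation K := {fraction R}.
Implicit Types (A B C D E G I J L M N P Q S X : set K).
Implicit Types (b e m t u x y z : K) (a r s : R).

Hypothesis R_strong_mori : strong_mori_domain R.

Lemma t_maximal_v_closed M : t_maximal M -> v_closed M.
Proof.
move=> tM; rewrite /v_closed -(t_closureE R_strong_mori).
  by case: tM => [[_ _ <-] _] x.
exact: t_maximal_ideal.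
Qed.

(** If [X] missed the complement of [M] in [R], it would lie in a prime [N] of [E] over [M], equal
    to some [Q = (M :_E b)]; as [1] is in [X^v], this would put [b] in [M]. *)
Lemma t_maximal_locally_invertible M (E := colon M M)
    (X := prodI M (colon E M)) : t_maximal M -> v_closure X 1 ->
  exists2 s : R, ~ M s%:F & X s%:F.
Proof.
move=> tM X1; apply: contrapT => noS.
have iM := t_maximal_ideal tM; have vM := t_maximal_v_closed tM.
have oE : overring E by exact: colon_overring.
have vE : v_closed E by exact: colon_v_closed.
have [iE wE E1 [sE EM]] := oE; have [sM _ _] := iM.
have mM : emodule E M by split=> // e x Ee Mx; exact: Ee.
have ME : M `<=` E.
  by move=> x /(t_maximal_sub_baseR tM)[a _ <-]; exact: overring_tofrac.
have XE : X `<=` E.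
  by apply: prodI_sub => // x y Mx; rewrite mulrC; apply.
have mX : emodule E X.
  split; first exact: prodI_submodule.
  move=> e x Ee; apply: (@prodI_sub _ _ _ [set x | X (e * x)]).
    exact/submodule_preim/prodI_submodule.
  by move=> m y Mm Ey /=; rewrite mulrA; apply: prodI_mul => //; exact: Ee.
have MX : M `<=` X.
  move=> x Mx; rewrite -[x]mulr1; apply: prodI_mul => // y My.
  by rewrite mul1r; exact: ME.
have EX : colon E X `<=` E.
  by move=> x xX; rewrite -[x]mulr1; move: X1; apply: v_closure_mul_sub.
(* If [b (E : M)] is inside [E], then [b X] is inside [M] because [E = (M : M)]; now [1] in [X^v]
   gives [b] in [M]. *)
have EEM b : (forall y, colon E M y -> E (b * y)) -> M b.
  move=> bE; rewrite -[b]mulr1; move: X1; apply: v_closure_mul_sub => //.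
  move=> x; apply: (@prodI_sub _ _ _ [set x | M (b * x)]).
    exact: submodule_preim.
  by move=> m y Mm /bE by_; have := by_ _ Mm; rewrite /= mulrAC mulrA.
(* The contraction to [E] of the localization of [X] at [M] is [w]-closed, as [exists_prime_colon]
   requires. *)
pose X' := E `&` [set z | exists2 s : R, ~ M s%:F & X (s%:F * z)].
have XX' : X `<=` X'.
  move=> x Xx; split; first exact: XE.
  by exists 1; [exact: t_maximal_not1F|rewrite tofrac1 mul1r].
have mX' : emodule E X'.
  have [[X0 XD XZ] EXM] := mX; split; last first.
    move=> e x Ee [Ex [s Ms Xsx]]; split; first exact: EM.
    by exists s => //; rewrite mulrCA; exact: EXM.
  apply: submoduleI => //; split=> /=.
  - by exists 1; [exact: t_maximal_not1F|rewrite mulr0].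
  - move=> x y [s Ms Xsx] [r Mr Xry].
    exists (s * r); first exact: t_maximal_mul.
    have -> : (s * r)%:F * (x + y) = r%:F * (s%:F * x) + s%:F * (r%:F * y).
      by rewrite tofracM; ring.
    by apply: XD; exact: XZ.
  - by move=> a x [s Ms Xsx]; exists s => //; rewrite mulrCA; exact: XZ.
have wX' : w_closed X'.
  move=> x xw; split; first by apply: wE => M' /xw[s Ms []]; exists s.
  have [s Ms [_ [r Mr Xrsx]]] := xw M tM.
  by exists (r * s); [exact: t_maximal_mul|rewrite tofracM -mulrA].
have X'E : X' `<=` E by move=> ? [].
have iX' : ideal X' by apply: (emodule_ideal oE iM) => //; exact: subset_trans XX'.
have [||_ _ [s [Ms <-]] [r [Mr <-]]|_ [s [Ms <-]] [_ [r Mr]]|b0 [Eb0 pN NS]] :=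
    @exists_prime_colon _ R_strong_mori E X'
      [set x | exists s : R, ~ M s%:F /\ s%:F = x] oE iX' wX' mX' X'E.
- by exists 1; split; [exact: t_maximal_not1F|exact: tofrac1].
- by move=> _ [s [_ <-]]; exact: overring_tofrac.
- by exists (s * r); split; [exact: t_maximal_mul|rewrite tofracM].
- rewrite -tofracM => Xrs; apply: noS; exists (r * s) => //.
  exact: t_maximal_mul.
set N := colon_in E X' b0 in pN NS.
have NM a : N a%:F -> M a%:F.
  by move=> Na; apply: contrapT => Ma; apply: NS Na; exists a.
have XN : X `<=` N by apply: subset_trans XX' _; exact: sub_colon_in.
have MN := subset_trans MX XN.
have [|||x [Ex Nx]|b [Eb pQ QS]] := @exists_prime_colon _ R_strong_mori E M
    [set x | E x /\ ~ N x] oE iM (v_closed_w_closed vM) mM ME.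
- by split=> //; case: pN.
- by move=> ? [].
- move=> x y [Ex Nx] [Ey Ny]; split; first exact: EM.
  by case: pN => _ _ _ pN /(pN _ _ Ex Ey)[].
- by move=> /MN.
set Q := colon_in E M b in pQ QS.
have QN : Q `<=` N by move=> x Qx; apply: contrapT => Nx; apply: (QS x) => //;
  split=> //; case: Qx.
have MQ : M `<=` Q by exact: sub_colon_in.
have NQ := primes_over_t_maximal_incomparable R_strong_mori oE tM pQ pN QN MQ NM.
have [_ _ Q1 _] := pQ; apply: Q1; split=> //; rewrite mul1r.
(* [b X] is inside [M] because [X] is inside [Q]; so for [y] in [(E : M)], [b y] multiplies [X] into
   [E] and lies in [E]. *)
apply: EEM => y yM; apply: EX => z /XN/NQ[_ Mzb].
by have := yM _ Mzb; congr (E _); ring.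
Qed.

(** * Submodules of [E] saturated outside [M], in place of [R_M]-modules *)

Definition saturated_in E M D : Prop :=
  forall s x, ~ M s%:F -> E x -> D (s%:F * x) -> D x.

(** Inside the [w]-closed [E], a denominator at the single ideal [M] suffices; the maximal condition
    thus reaches saturated modules. *)
Lemma saturated_w_closed E M D :
  t_maximal M -> w_closed E -> D `<=` E -> saturated_in E M D -> w_closed D.
Proof.
move=> tM wE DE satD x xw; have [s Ms Dsx] := xw M tM; apply: satD Ms _ Dsx.
by apply: wE => M' /xw[r Mr /DE]; exists r.
Qed.

Lemma saturated_maximal E M D0 (F : set (set K)) : overring E -> t_maximal M ->
  ideal D0 -> F !=set0 ->
  (forall B, F B -> [/\ submodule B, saturated_in E M B, D0 `<=` B & B `<=` E]) ->
  exists2 B, F B & forall B', F B' -> B `<=` B' -> B' `<=` B.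
Proof.
move=> oE tM [_ [x Dx x0] _] F0 FP; have [iE wE _ _] := oE.
apply: (w_closed_maximal R_strong_mori iE F0) => B /FP[sB satB DB BE].
split=> //; last exact: saturated_w_closed satB.
by apply: (@ideal_subset _ _ E x) => //; exact: DB.
Qed.

(** The contraction to [E] of [B_M + R_M x]. *)
Definition adjoin_in E M B x : set K :=
  E `&` [set z | exists2 s : R, ~ M s%:F & exists r : R, B (s%:F * z - r%:F * x)].

Lemma adjoin_in_sub E M B x :
  t_maximal M -> B `<=` E -> B `<=` adjoin_in E M B x.
Proof.
move=> tM BE z Bz; split; first exact: BE.
exists 1; first exact: t_maximal_not1F.
by exists 0; rewrite tofrac1 tofrac0 mul1r mul0r subr0.
Qed.

Lemma adjoin_in_mem E M B x :
  t_maximal M -> submodule B -> E x -> adjoin_in E M B x x.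
Proof.
move=> tM [B0 _ _] Ex; split=> //; exists 1; first exact: t_maximal_not1F.
by exists 1; rewrite subrr.
Qed.

Lemma adjoin_in_submodule E M B x :
  t_maximal M -> submodule E -> submodule B -> submodule (adjoin_in E M B x).
Proof.
move=> tM sE [B0 BD BZ]; apply: submoduleI => //; split=> /=.
- exists 1; first exact: t_maximal_not1F.
  by exists 0; rewrite tofrac0 mulr0 mul0r subr0.
- move=> y z [s Ms [r By]] [s' Ms' [r' Bz]].
  exists (s * s'); first exact: t_maximal_mul.
  exists (s' * r + s * r').
  have -> : (s * s')%:F * (y + z) - (s' * r + s * r')%:F * x =
      s'%:F * (s%:F * y - r%:F * x) + s%:F * (s'%:F * z - r'%:F * x).
    by rewrite tofracD !tofracM; ring.
  by apply: BD; exact: BZ.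
- move=> a z [s Ms [r Bz]]; exists s => //; exists (a * r).
  have -> : s%:F * (a%:F * z) - (a * r)%:F * x = a%:F * (s%:F * z - r%:F * x).
    by rewrite tofracM; ring.
  exact: BZ.
Qed.

Lemma adjoin_in_saturated E M B x :
  t_maximal M -> saturated_in E M (adjoin_in E M B x).
Proof.
move=> tM s z Ms Ez [_ [s' Ms' [r Bz]]]; split=> //.
exists (s' * s); first exact: t_maximal_mul.
by exists r; rewrite tofracM -mulrA.
Qed.

(* Nakayama's lemma over [R_M]: a submodule [B] maximal among those with
   [D' <= B < D] gives [D = B + R_M x], and then [(s - a) x] lies in [B] for
   some [s] outside and some [a] inside [M]. *)
Lemma saturated_nakayama E M D D' : overring E -> t_maximal M ->
  submodule D -> D `<=` E -> saturated_in E M D ->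
  ideal D' -> D' `<=` D -> saturated_in E M D' ->
  (forall x, D x -> exists2 s : R, ~ M s%:F &
     exists2 d, D' d & prodI M D (s%:F * x - d)) ->
  D `<=` D'.
Proof.
move=> oE tM sD DE satD iD' D'D satD' DM; apply: contrapT => DD'.
have [[sE _ _] _ _ _] := oE; have [sM _ _] := t_maximal_ideal tM.
pose F := [set B | [/\ submodule B, saturated_in E M B, D' `<=` B, B `<=` D &
  ~ D `<=` B]].
have [|B [sB satB D'B BD DB]|B [sB satB D'B BD DB] maxB] :=
    saturated_maximal (F := F) oE tM iD'.
- by exists D'; split=> //; case: iD'.
- by split=> //; exact: subset_trans DE.
apply: DB => x Dx; apply: contrapT => Bx.
have [B0 BA BZ] := sB.
pose B' := D `&` adjoin_in E M B x.
have DB' : D `<=` B'.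
  apply: contrapT => DB'; apply: Bx; apply: (maxB B').
  - split=> //.
    + by apply: submoduleI => //; exact: adjoin_in_submodule.
    + move=> s z Ms Ez [Dz B'z]; split; first exact: satD Dz.
      exact: adjoin_in_saturated B'z.
    + move=> z D'z; split; first exact: D'D.
      apply: adjoin_in_sub => //; first exact: subset_trans DE.
      exact: D'B.
    + by move=> ? [].
  - move=> z Bz; split; first exact: BD.
    by apply: adjoin_in_sub => //; exact: subset_trans DE.
  - by split=> //; apply: adjoin_in_mem => //; exact: DE.
have MDx w : prodI M D w -> exists2 s : R, ~ M s%:F &
    exists2 a : R, M a%:F & B (s%:F * w - a%:F * x).
  apply: (@prodI_min _ _ _ [set w | exists2 s : R, ~ M s%:F &
    exists2 a : R, M a%:F & B (s%:F * w - a%:F * x)]) => /=.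
  - exists 1; first exact: t_maximal_not1F.
    by exists 0; rewrite ?tofrac0 ?mulr0 ?mul0r ?subr0 //; case: sM.
  - move=> y z [s Ms [a Ma By]] [s' Ms' [a' Ma' Bz]].
    exists (s * s'); first exact: t_maximal_mul.
    exists (s' * a + s * a').
      by case: sM => _ MD MZ; rewrite tofracD !tofracM; apply: MD; exact: MZ.
    have -> : (s * s')%:F * (y + z) - (s' * a + s * a')%:F * x =
        s'%:F * (s%:F * y - a%:F * x) + s%:F * (s'%:F * z - a'%:F * x).
      by rewrite tofracD !tofracM; ring.
    by apply: BA; exact: BZ.
  - move=> m z Mm /DB'[_ [_ [s Ms [r Bz]]]].
    have [c _ cE] := t_maximal_sub_baseR tM Mm; exists s => //.
    exists (c * r).
      by case: sM => _ _ MZ; rewrite mulrC tofracM cE; exact: MZ.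
    have -> : s%:F * (m * z) - (c * r)%:F * x = c%:F * (s%:F * z - r%:F * x).
      by rewrite tofracM cE; ring.
    exact: BZ.
have [s Ms [d D'd /MDx[s' Ms' [a Ma Bx']]]] := DM _ Dx.
apply: Bx; apply: (satB (s' * s - a)); last 1 first.
- have -> : (s' * s - a)%:F * x =
      (s'%:F * (s%:F * x - d) - a%:F * x) + s'%:F * d.
    by rewrite tofracB tofracM; ring.
  by apply: BA => //; apply/BZ/D'B.
- move=> Msa; apply: (t_maximal_mul tM Ms' Ms).
  rewrite -[s' * s](subrK a) tofracD.
  by case: sM => _ MD _; exact: MD.
- exact: DE.
Qed.

(* [E / M E] is locally a finite-dimensional space over [R_M / M R_M].  In place
   of a dimension, take [B] maximal among the submodules containing the
   intersection [A_oo] of the chain for which some [A j] meets [B] in [A_oo]. *)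
Lemma saturated_dcc E M (A : nat -> set K) : overring E -> t_maximal M ->
  (forall x y, M x -> E y -> M (x * y)) ->
  (forall j, [/\ submodule (A j), saturated_in E M (A j), M `<=` A j & A j `<=` E]) ->
  (forall j, A j.+1 `<=` A j) ->
  exists j, A j `<=` A j.+1.
Proof.
move=> oE tM ME AP AS; have [[sE _ _] _ _ _] := oE.
have Amono i j : (i <= j)%N -> A j `<=` A i.
  move=> /subnKC <-; elim: (j - i)%N => [|n IH]; first by rewrite addn0.
  by rewrite addnS; exact: subset_trans IH.
pose Aoo := \bigcap_j A j.
have sAoo : submodule Aoo.
  split; first by move=> j _; case: (AP j) => [[]].
  - move=> x y xA yA j _; case: (AP j) => [[_ AD _] _ _ _].
    by apply: AD; [exact: xA|exact: yA].
  - move=> a x xA j _; case: (AP j) => [[_ _ AZ] _ _ _].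
    by apply: AZ; exact: xA.
have satAoo : saturated_in E M Aoo.
  move=> s x Ms Ex xA j _; case: (AP j) => [_ satA _ _].
  by apply: satA Ms Ex _; exact: xA.
have MAoo : M `<=` Aoo by move=> x Mx j _; case: (AP j) => [_ _ + _]; apply.
pose F := [set B | [/\ submodule B, saturated_in E M B, Aoo `<=` B, B `<=` E &
  exists j, B `&` A j `<=` Aoo]].
have [|B [sB satB AB BE _]|B [sB satB AB BE [j BAj]] maxB] :=
    saturated_maximal (F := F) oE tM (t_maximal_ideal tM).
- exists Aoo; split=> //; last by exists 0%N => ? [].
  by move=> x /(_ 0%N I); case: (AP 0%N) => _ _ _; apply.
- by split=> //; exact: subset_trans AB.
(* A point [x] of [A j] outside [Aoo] misses some [A j']; adjoining [x] to [B] keeps the trace on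
   [A j'] inside [Aoo], against maximality. *)
exists j; suff AjA : A j `<=` Aoo by move=> x /AjA; exact.
move=> x Ajx; apply: contrapT => Ax.
have [j' Aj'x] : exists j', ~ A j' x.
  by apply: contrapT => allA; apply: Ax => i _; apply: contrapT => ?;
    apply: allA; exists i.
have jj' : (j <= j')%N.
  rewrite leqNgt; apply/negP => /ltnW /Amono; by move=> /(_ _ Ajx).
have [_ _ _ AjE] := AP j; have Ex := AjE _ Ajx.
have Bx : ~ B x by move=> Bx; apply: Ax; exact: BAj.
apply: Bx; apply: (maxB (adjoin_in E M B x)).
- split.
  + exact: adjoin_in_submodule.
  + exact: adjoin_in_saturated.
  + by apply: subset_trans AB _; exact: adjoin_in_sub.
  + by move=> ? [].
  exists j' => z [[Ez [s Ms [r Bz]]] Aj'z].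
  (* For [r] in [M], [r x] is in [M], so [s z] lies in [B] and in [A j]. For [r] outside [M], [x]
     would fall into [A j']. *)
  have [Mr|Mr] := pselect (M r%:F).
    apply: (satAoo s) => //; apply: BAj; split.
      rewrite -[_ * z](subrK (r%:F * x)); case: sB => _ BD _; apply: BD => //.
      exact/AB/MAoo/ME.
    have [[_ _ AZ] _ _ _] := AP j; apply: AZ; exact: Amono Aj'z.
  exfalso; apply: Aj'x; have [sAj' satA _ _] := AP j'.
  have [_ _ AZ] := sAj'.
  apply: (satA r) => //.
  have -> : r%:F * x = s%:F * z - (s%:F * z - r%:F * x) by ring.
  apply: submoduleB => //; first exact: AZ.
  suff : Aoo (s%:F * z - r%:F * x) by exact.
  apply: BAj; split=> //; have [sA _ _ _] := AP j; have [_ _ AZj] := sA.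
  by apply: submoduleB => //; apply: AZj => //; exact: Amono Aj'z.
- exact: adjoin_in_sub.
- exact: adjoin_in_mem.
Qed.

End Dimension.

(** * The ideal transform and dimension one *)

Section Height.
Set Implicit Arguments.
Unset Strict Implicit.
Unset Printing Implicit Defensive.
Variable R : idomainType.
Local Notation K := {fraction R}.
Implicit Types (A B C D E G I J L M N P Q S X : set K).
Implicit Types (b e m t u x y z : K) (a r s : R).

Hypothesis R_strong_mori : strong_mori_domain R.

Lemma prime_exp P a n : prime_ideal P -> ~ P a%:F -> ~ P (a ^+ n)%:F.
Proof.
move=> [iP PR pP] Pa; elim: n => [|n IH].
  by rewrite expr0 tofrac1; exact: proper_not1.
by rewrite exprS => /pP[].
Qed.

Lemma bigcup_submodule (G : nat -> set K) : (forall i, submodule (G i)) ->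
  (forall i, G i `<=` G i.+1) -> submodule (\bigcup_i G i).
Proof.
move=> sG GS.
have Gmono i j : (i <= j)%N -> G i `<=` G j.
  move=> /subnKC <-; elim: (j - i)%N => [|n IH]; first by rewrite addn0.
  by rewrite addnS; exact: subset_trans (GS _).
split; first by exists 0%N => //; case: (sG 0%N).
- move=> x y [i _ Gx] [j _ Gy]; exists (maxn i j) => //.
  have [_ GD _] := sG (maxn i j).
  by apply: GD; [apply: Gmono Gx; rewrite leq_maxl|apply: Gmono Gy; rewrite leq_maxr].
- by move=> a x [i _ Gx]; exists i => //; case: (sG i) => _ _; apply.
Qed.

Section Transform.
Variables (E M : set K).
Hypotheses (oE : overring E) (tM : t_maximal M).
Hypothesis ME : forall x y, M x -> E y -> M (x * y).

(** Successive colons [(E_M : M^i)], starting from [E_M]; their union [T] is the ideal transform. *)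
Fixpoint transform i : set K :=
  if i is i'.+1 then colon (transform i') M
  else [set x | exists2 s : R, ~ M s%:F & E (s%:F * x)].

Let sME : M `<=` E.
Proof.
by move=> x /(t_maximal_sub_baseR tM)[a _ <-]; exact: overring_tofrac.
Qed.

Lemma transform_submodule i : submodule (transform i).
Proof.
elim: i => [|i IH]; last exact: colon_submodule.
have [[[E0 ED EZ] _ _] _ _ _] := oE; split=> /=.
- by exists 1; [exact: t_maximal_not1F|rewrite mulr0].
- move=> x y [s Ms Ex] [r Mr Ey].
  exists (s * r); first exact: t_maximal_mul.
  have -> : (s * r)%:F * (x + y) = r%:F * (s%:F * x) + s%:F * (r%:F * y).
    by rewrite tofracM; ring.
  by apply: ED; exact: EZ.
- by move=> a x [s Ms Ex]; exists s => //; rewrite mulrCA; exact: EZ.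
Qed.

Lemma transform_mul i e x : E e -> transform i x -> transform i (e * x).
Proof.
move=> Ee; elim: i x => [|i IH] x /=.
  move=> [s Ms Ex]; exists s => //; rewrite mulrCA.
  by case: oE => _ _ _ [_]; apply.
by move=> Tx y My; rewrite -mulrA; apply/IH/Tx.
Qed.

Lemma transformS i : transform i `<=` transform i.+1.
Proof. by move=> x Tx y My; rewrite mulrC; apply: transform_mul => //; exact: sME. Qed.

Lemma transform_colon i u x :
  colon E M u -> transform i x -> transform i.+1 (u * x).
Proof.
by move=> uE Tx y My; rewrite mulrAC; apply: transform_mul => //; exact: uE.
Qed.

Lemma transform_saturated i s x :
  ~ M s%:F -> transform i (s%:F * x) -> transform i x.
Proof.
move=> Ms; elim: i x => [|i IH] x /=; last first.
  by move=> Tsx y My; apply: IH; rewrite mulrA; exact: Tsx.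
move=> [r Mr Ersx]; exists (r * s); first exact: t_maximal_mul.
by rewrite tofracM -mulrA.
Qed.

Lemma transform_exp i m x : M m -> transform i x -> transform 0 (m ^+ i * x).
Proof.
move=> Mm; elim: i x => [|i IH] x; first by rewrite expr0 mul1r.
by move=> /(_ _ Mm)/IH; rewrite exprS; congr transform; ring.
Qed.

Let T := \bigcup_i transform i.

Let sT : submodule T.
Proof. exact: bigcup_submodule transform_submodule transformS. Qed.

(* [E] intersected with [y^j T], where [T] is the
   ideal transform of [E_M] with respect to [M]. *)
Definition transform_filtration y j : set K :=
  E `&` [set t | T (y ^- j * t)].

Lemma transform_filtration_submodule y j : submodule (transform_filtration y j).
Proof. by apply: submoduleI; [case: oE => [[]]|exact: submodule_preim]. Qed.

Lemma transform_filtration_saturated y j :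
  saturated_in E M (transform_filtration y j).
Proof.
move=> s x Ms Ex [_ [i _ Tx]]; split=> //; exists i => //.
by apply: (@transform_saturated i s) => //; rewrite mulrCA.
Qed.

Lemma transform_filtration_exp y j : E y -> y != 0 -> transform_filtration y j (y ^+ j).
Proof.
have [_ _ E1 [_ EM]] := oE; move=> Ey y0; split.
  by elim: j => [|j IH]; rewrite ?expr0 // exprS; exact: EM.
rewrite /= mulVf ?expf_neq0 //; exists 0%N => //=.
by exists 1; [exact: t_maximal_not1F|rewrite tofrac1 mulr1].
Qed.

Lemma transform_filtrationS y j : E y -> y != 0 ->
  transform_filtration y j.+1 `<=` transform_filtration y j.
Proof.
move=> Ey y0 x [Ex [i _ Tx]]; split=> //; exists i => //.
have -> : y ^- j * x = y * (y ^- j.+1 * x).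
  by rewrite exprS invfM !mulrA mulfV ?mul1r.
exact: transform_mul.
Qed.

(** The filtration enlarged by [M], localized at [M] and contracted to [E]: [saturated_dcc] asks for
    modules containing [M]. *)
Definition transform_filtration_mod y j : set K :=
  E `&` [set z | exists2 s : R, ~ M s%:F &
                 exists2 d, transform_filtration y j d & M (s%:F * z - d)].

Lemma transform_filtration_mod_submodule y j :
  submodule (transform_filtration_mod y j).
Proof.
have [M0 MD MZ] := ideal_submodule (t_maximal_ideal tM).
have [D0 DD DZ] := transform_filtration_submodule y j.
apply: submoduleI; first by case: oE => [[]].
split=> /=.
- exists 1; first exact: t_maximal_not1F.
  by exists 0; rewrite // mulr0 subr0.
- move=> x z [s Ms [d Dd Mx]] [r Mr [d' Dd' Mz]].
  exists (s * r); first exact: t_maximal_mul.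
  exists (r%:F * d + s%:F * d'); first by apply: DD; exact: DZ.
  have -> : (s * r)%:F * (x + z) - (r%:F * d + s%:F * d') =
      r%:F * (s%:F * x - d) + s%:F * (r%:F * z - d').
    by rewrite tofracM; ring.
  by apply: MD; exact: MZ.
- move=> a x [s Ms [d Dd Mx]]; exists s => //.
  exists (a%:F * d); first exact: DZ.
  by rewrite mulrCA -mulrBr; exact: MZ.
Qed.

(** Modulo [M] the filtration stops by [saturated_dcc]. The error lies in [M] and in step [j]; local
    invertibility puts it in [M] times step [j], since [T] is stable under [(E : M)], and Nakayama's
    lemma concludes. *)
Lemma transform_filtration_stable y : E y -> y != 0 ->
  (exists2 s : R, ~ M s%:F & prodI M (colon E M) s%:F) ->
  exists j, transform_filtration y j `<=` transform_filtration y j.+1.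
Proof.
move=> Ey y0 [s0 Ms0 Xs0]; have [iE _ _ [sE EM]] := oE.
have [M0 MD MZ] := ideal_submodule (t_maximal_ideal tM).
have [j Aj] : exists j,
    transform_filtration_mod y j `<=` transform_filtration_mod y j.+1.
  apply: (saturated_dcc R_strong_mori oE tM) => //.
  - move=> j; split; first exact: transform_filtration_mod_submodule.
    + move=> s x Ms Ex [_ [r Mr [d Dd Md]]]; split=> //.
      exists (r * s); first exact: t_maximal_mul.
      by exists d => //; rewrite tofracM -mulrA.
    + move=> x Mx; split; first exact: sME.
      exists 1; first exact: t_maximal_not1F.
      exists 0; last by rewrite tofrac1 mul1r subr0.
      by case: (transform_filtration_submodule y j).
    + by move=> ? [].
  - move=> j x [Ex [s Ms [d Dd Md]]]; split=> //; exists s => //.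
    by exists d => //; exact: transform_filtrationS.
exists j; pose D := transform_filtration y.
have DE k : D k `<=` E by move=> ? [].
have sD k : submodule (D k) by exact: transform_filtration_submodule.
have iD' : ideal (D j.+1).
  apply: (@ideal_subset _ _ E (y ^+ j.+1)) => //.
    exact: transform_filtration_exp.
  exact: expf_neq0.
apply: (saturated_nakayama R_strong_mori oE tM) => //.
- exact: transform_filtration_saturated.
- exact: transform_filtrationS.
- exact: transform_filtration_saturated.
move=> x Dx; have [|_ [s Ms [d Dd Mm]]] := Aj x.
  split; first exact: DE Dx.
  exists 1; first exact: t_maximal_not1F.
  by exists x => //; rewrite tofrac1 mul1r subrr.
exists (s0 * s); first exact: t_maximal_mul.
exists (s0%:F * d); first by case: (sD j.+1) => _ _; apply.
rewrite tofracM -mulrA -mulrBr.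
set m := s%:F * x - d in Mm *.
have Dm : D j m.
  apply: submoduleB => //; last exact: transform_filtrationS.
  by case: (sD j) => _ _; apply.
(* [s0] is a sum of products [p u] with [p] in [M] and [u] in [(E : M)]; each [u m] stays in step
   [j], one colon further in [T]. *)
suff: [set z | prodI M (D j) (m * z)] s0%:F by rewrite /= mulrC.
apply: prodI_sub Xs0 => /=.
  exact/submodule_preim/prodI_submodule/ideal_submodule/t_maximal_ideal.
move=> p u Mp uE; rewrite mulrCA; apply: prodI_mul => //; split.
  by rewrite mulrC; exact: uE.
have [_ [i _ Tm]] := Dm; exists i.+1 => //.
by have := transform_colon uE Tm; congr (transform _); ring.
Qed.

(** For [y != 0] in [P], a stationary filtration puts [y^-1] in [T]; so a power of each [m] in [M]
    is, up to a factor outside [M], a multiple of [y], and the prime [P] contains [m]. *)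
Lemma prime_sub_invertible P : prime_ideal P -> P `<=` M ->
  (exists2 s : R, ~ M s%:F & prodI M (colon E M) s%:F) -> M `<=` P.
Proof.
move=> pP PM Xs m Mm; apply: contrapT => Pm.
have [[iP PR] _ primeP] := pP; have [[_ _ PZ] [y Py y0] _] := iP.
have Ey : E y by apply: sME; exact: PM.
have [j Dj] := transform_filtration_stable Ey y0 Xs.
have [_ [i _]] := Dj _ (transform_filtration_exp j Ey y0).
rewrite exprS invfM -mulrA mulVf ?expf_neq0 // mulr1.
move=> /(transform_exp Mm)[s Ms Es].
have [a _ aE] := t_maximal_sub_baseR tM Mm.
(* One more factor [m] moves the element of [E] into [M], hence into [R]; this explains the exponent
   [i.+1]. *)
have [c _ cE] := t_maximal_sub_baseR tM (ME Mm Es).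
have : P (s * a ^+ i.+1)%:F.
  suff -> : (s * a ^+ i.+1)%:F = c%:F * y by exact: PZ.
  rewrite tofracM tofracXn aE cE exprS.
  have -> : m * (s%:F * (m ^+ i / y)) * y = s%:F * (m * m ^+ i) * (y^-1 * y).
    by ring.
  by rewrite mulVf ?mulr1.
move=> /primeP[/PM //|]; apply: prime_exp => //.
by rewrite aE.
Qed.

End Transform.

Lemma stable_t_maximal_height_one M P : t_maximal M -> t_stable M ->
  prime_ideal P -> P `<=` M -> M `<=` P.
Proof.
move=> tM stM pP PM.
have iM := t_maximal_ideal tM; have vM := t_maximal_v_closed R_strong_mori tM.
have tMM : t_closure M = M by case: tM => [[_ _ <-]].
move: stM; rewrite /t_stable /t_endo tMM => stM.
have oE : overring (colon M M) by exact: colon_overring.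
apply: (prime_sub_invertible oE) => //.
  by move=> x y Mx; rewrite mulrC; apply.
apply: t_maximal_locally_invertible => //.
by apply: t_closure_sub_v; rewrite stM => x; rewrite mul1r.
Qed.

Lemma exists_t_maximal_nonfield : ~ GRing.field_axiom R -> exists M, @t_maximal R M.
Proof.
move=> nF; have [a a0 aU] : exists2 a : R, a != 0 & a \isn't a GRing.unit.
  apply: contrapT => allU; apply: nF => a a0; apply: contrapT => /negP aU.
  by apply: allU; exists a.
have a0' := tofrac_neq0 a0.
have iA := scaleI_ideal a0' (baseR_ideal R).
have [|M tM _] := @exists_t_maximal R (scaleI a%:F (@baseR R)); last by exists M.
split.
- split=> // _ [_ [b _ <-] <-]; rewrite -tofracM; exact: baseR_tofrac.
- move=> AR; have [_ [b _ <-]] : scaleI a%:F (@baseR R) 1.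
    by rewrite AR; exact: baseR1.
  rewrite -tofracM -tofrac1 => /eqP; rewrite tofrac_eq => /eqP ab1.
  move/negP: aU; apply; apply/unitrP; exists b.
  by rewrite mulrC ab1.
- by rewrite v_closed_t_closure //; apply: scaleI_v_closed => //;
    exact: baseR_v_closed.
Qed.

(** A strict inclusion of prime [t]-ideals is a chain of length two; a [t]-maximal ideal, which
    exists when [R] is not a field, is one of length one. *)
Lemma t_dimension_one : ~ GRing.field_axiom R ->
  t_dimension_is R 1 <-> (forall P Q : set K, prime_t_ideal P ->
    prime_t_ideal Q -> P `<=` Q -> Q `<=` P).
Proof.
move=> nF; split=> [[ub1 _] P Q tP tQ PQ|dim1].
  apply: contrapT => QP; suff /ub1 : prime_t_chain R 2 by [].
  exists (fun i => if i is 0%N then P else Q); split.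
    by case.
  by case=> [|[]] // _; split.
split=> [n [P [tP PS]]|n].
  case: n tP PS => [|[|n]] // tP PS.
  by case: (PS 0%N isT) => P01; case; apply: dim1 => //; exact: tP.
apply; have [M tM] := exists_t_maximal_nonfield nF.
by exists (fun=> M); split=> // i _; exact: t_maximal_prime_t_ideal.
Qed.

Lemma stable_t_maximal_dimension_one : ~ GRing.field_axiom R ->
  (forall M : set K, t_maximal M -> t_stable M) -> t_dimension_is R 1.
Proof.
move=> nF stM; apply/t_dimension_one => // P Q [pP _] tQ PQ.
have [M tM QM] := prime_t_ideal_sub_t_maximal tQ.
apply: (subset_trans QM); apply: stable_t_maximal_height_one => //.
  exact: stM.
exact: subset_trans QM.
Qed.

(** * Regularity and stability of a single ideal *)

Lemma boole_clifford I : ideal I -> boole_t_regular I -> clifford_t_regular I.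
Proof.
move=> iI [x x0 bI]; have iII := prodI_ideal iI iI.
(* From [(I^2)^t = x I^t], the Clifford partner of [I] is [x^-1 R]. *)
have iJ : ideal (scaleI x^-1 (@baseR R)).
  by apply: scaleI_ideal; [rewrite invr_eq0|exact: baseR_ideal].
exists (scaleI x^-1 (@baseR R)) => //.
have iIIJ := prodI_ideal iII iJ.
move: bI; rewrite !(t_closureE R_strong_mori) // => bI.
apply/seteqP; split.
  move=> y Iy; have : v_closure (prodI I I) (x * y) by rewrite bI; exists y.
  rewrite -{2}[y](mulKf x0); move: (x * y); apply: v_closure_mul_sub.
    exact: v_closure_v_closed.
  move=> z IIz; apply: sub_v_closure; rewrite mulrC; apply: prodI_mul => //.
  by exists 1; [exact: baseR1|rewrite mulr1].
apply: v_closure_sub; first exact: v_closure_v_closed.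
apply: prodI_sub; first exact: v_closure_submodule.
move=> y _ /(@sub_v_closure R)+ [_ [a _ <-] <-].
rewrite bI => -[z Iz <-]; have [_ _ VZ] := v_closure_submodule I.
have -> : x * z * (x^-1 * a%:F) = a%:F * ((x * x^-1) * z) by ring.
by rewrite mulfV // mul1r; exact: VZ.
Qed.

Lemma clifford_t_stable I :
  (forall P Q : set K, prime_t_ideal P -> prime_t_ideal Q -> P `<=` Q -> Q `<=` P) ->
  ideal I -> clifford_t_regular I -> t_stable I.
Proof.
move=> dim1 iI [J iJ]; rewrite /t_stable /t_endo.
rewrite (t_closureE _ (prodI_ideal (prodI_ideal iI iI) iJ)) // t_closureE //.
set A := v_closure I => AE.
have iA : ideal A by exact: v_closure_ideal.
have vA : v_closed A by exact: v_closure_v_closed.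
have IA : I `<=` A by exact: sub_v_closure.
set E := colon A A; have oE : overring E by exact: colon_overring.
have vE : v_closed E by exact: colon_v_closed.
have [iE wE E1 [sE EM]] := oE.
have iC := colon_ideal iE iA; set C := colon E A in iC *.
have iAC := prodI_ideal iA iC.
rewrite t_closureE //; set L := v_closure _.
have LE : L `<=` E.
  apply: v_closure_sub => //; apply: prodI_sub => // x y Ax.
  by rewrite mulrC; apply.
have mL : emodule E L.
  split=> [|e x Ee Lx]; first exact: v_closure_submodule.
  move: x Lx; apply: v_closure_mul_sub; first exact: v_closure_v_closed.
  apply: (@prodI_sub _ _ _ [set x | L (e * x)]).
    exact/submodule_preim/v_closure_submodule.
  move=> x y Ax Cy /=; apply/sub_v_closure; rewrite mulrA.
  by apply: prodI_mul => //; exact: Ee.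
(* [A A J] lies in [A] by regularity, so [A J] lies in [E], that is, [J] is inside [(E : A)]. *)
have JC j (a : K) : J j -> A a -> E (a * j).
  move=> Jj Aa b Ab.
  have bj i i' : I i -> I i' -> A (i * i' * j).
    by move=> Ii Ii'; rewrite AE; apply/sub_v_closure/prodI_mul => //; exact: prodI_mul.
  have -> : a * j * b = j * b * a by ring.
  move: a Aa; apply: v_closure_mul_sub => // i Ii.
  have -> : j * b * i = j * i * b by ring.
  move: b Ab; apply: v_closure_mul_sub => // i' Ii'.
  by have := bj _ _ Ii Ii'; congr A; ring.
(* [A] is the closure of the products [i i' j], and [i j] is in [L]; so [x i i' j] is in [E A],
   inside [A]. *)
have EL : colon E L `<=` E.
  move=> x xL b Ab; have := Ab; rewrite {1}AE.
  move: b {Ab}; apply: v_closure_mul_sub => //.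
  apply: (@prodI_sub _ _ _ [set b | A (x * b)]); first exact/submodule_preim/ideal_submodule.
  move=> w j IIw Jj /=; rewrite mulrA mulrAC; move: w IIw.
  apply: (@prodI_sub _ _ _ [set b | A (x * j * b)]); first exact/submodule_preim/ideal_submodule.
  move=> i i' /IA Ai /IA Ai' /=.
  have -> : x * j * (i * i') = x * (i * j) * i' by ring.
  apply: xL => //; apply: sub_v_closure; apply: prodI_mul => //.
  by move=> b Ab; rewrite mulrC; exact: JC.
have L1 : L 1.
  apply: (divisorial_trivial_colon R_strong_mori oE vE dim1) => //.
    exact: v_closure_ideal.
  exact: v_closure_v_closed.
apply/seteqP; split=> // e Ee; rewrite -[e]mulr1.
by case: mL => _; apply.
Qed.

(** [A A] inside [x A] gives [A] inside [x E]. Conversely [x A (E : A)] is inside [A], because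
    [x A = (I^2)^v] and [I^2 (E : A)] is inside [A]; stability puts [1] in the closure of
    [A (E : A)], so [x] is in [A]. *)
Lemma boole_stable_strongly_t_stable I :
  ideal I -> boole_t_regular I -> t_stable I -> strongly_t_stable I.
Proof.
move=> iI [x x0 bI] stI; exists x; move: stI bI.
have iA := v_closure_ideal iI; have iII := prodI_ideal iI iI.
rewrite /t_stable /boole_t_regular /t_endo.
rewrite (t_closureE R_strong_mori iI) (t_closureE R_strong_mori iII).
set A := v_closure I in iA *; set E := colon A A => stI bI.
have vA : v_closed A by exact: v_closure_v_closed.
have IA : I `<=` A by exact: sub_v_closure.
have AA (a a' : K) : A a -> A a' -> scaleI x A (a * a').
  rewrite -bI; have vII := @v_closure_v_closed _ (prodI I I) => Aa Aa'.
  move: a' Aa'; apply: v_closure_mul_sub => // i' Ii'; rewrite mulrC.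
  move: a Aa; apply: v_closure_mul_sub => // i Ii.
  exact/sub_v_closure/prodI_mul.
apply/seteqP; split=> [a Aa|_ [e Ee <-]].
  apply/scaleIP => // b Ab; have [c Ac cE] := AA _ _ Aa Ab.
  by rewrite -mulrA -cE mulKf.
have X1 : v_closure (prodI A (colon E A)) 1.
  by apply: t_closure_sub_v; rewrite stI => b; rewrite mul1r.
suff Ax : A x by rewrite mulrC; exact: Ee.
rewrite -[x]mulr1; move: X1; apply: v_closure_mul_sub => //.
apply: (@prodI_sub _ _ _ [set b | A (x * b)]); first exact/submodule_preim/ideal_submodule.
move=> a c Aa Cc /=; rewrite mulrA.
have : scaleI x A `<=` [set z | A (z * c)].
  rewrite -bI => z zII; rewrite /= mulrC; move: z zII.
  apply: v_closure_mul_sub => //.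
  apply: (@prodI_sub _ _ _ [set b | A (c * b)]).
    exact/submodule_preim/ideal_submodule.
  move=> i i' /IA Ai /IA Ai' /=; rewrite mulrA.
  exact: Cc.
by apply; exists a.
Qed.

(** The partner of [I] is [(E : A)]: [I^2 (E : A)] is inside [A], and [a] in [A] is [a] times [1],
    with [1] in the closure of [A (E : A)]. *)
Lemma t_stable_clifford I : ideal I -> t_stable I -> clifford_t_regular I.
Proof.
move=> iI; rewrite /t_stable /t_endo (t_closureE R_strong_mori iI).
set A := v_closure I; set E := colon A A => stI.
have iA : ideal A by exact: v_closure_ideal.
have vA : v_closed A by exact: v_closure_v_closed.
have IA : I `<=` A by exact: sub_v_closure.
have iC : ideal (colon E A) by exact: colon_ideal (colon_ideal iA iA) iA.
exists (colon E A) => //; rewrite (t_closureE R_strong_mori iI).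
rewrite (t_closureE R_strong_mori (prodI_ideal (prodI_ideal iI iI) iC)).
have X1 : v_closure (prodI A (colon E A)) 1.
  by apply: t_closure_sub_v; rewrite stI => b; rewrite mul1r.
rewrite -/A; apply/seteqP; split; last first.
  apply: v_closure_sub => //; apply: prodI_sub; first exact: ideal_submodule.
  move=> w c IIw Cc; rewrite mulrC; move: w IIw.
  apply: (@prodI_sub _ _ _ [set b | A (c * b)]).
    exact/submodule_preim/ideal_submodule.
  move=> i i' /IA Ai /IA Ai' /=; rewrite mulrA.
  exact: Cc.
set V := v_closure _; have vV : v_closed V by exact: v_closure_v_closed.
move=> a Aa; rewrite -[a]mulr1; move: X1; apply: v_closure_mul_sub => //.
apply: (@prodI_sub _ _ _ [set b | V (a * b)]).
  exact/submodule_preim/v_closure_submodule.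
move=> b c Ab Cc /=; rewrite mulrA mulrC; rewrite mulrA; move: b Ab.
apply: v_closure_mul_sub => // i Ii; rewrite mulrAC; move: a Aa.
apply: v_closure_mul_sub => // i' Ii'.
rewrite -mulrA mulrC; apply/sub_v_closure/prodI_mul => //.
exact: prodI_mul.
Qed.

(** The generator serves again: [I^t = x E] gives [(I^2)^t = x^2 E = x I^t]. *)
Lemma strongly_t_stable_boole I :
  ideal I -> strongly_t_stable I -> boole_t_regular I.
Proof.
move=> iI [x]; have iA := v_closure_ideal iI; have iII := prodI_ideal iI iI.
rewrite /t_endo (t_closureE R_strong_mori iI).
set A := v_closure I in iA *; set E := colon A A => AE.
have vA : v_closed A by exact: v_closure_v_closed.
have x0 : x != 0.
  have [_ [a + a0] _] := iA; rewrite AE => -[e _ ea].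
  by apply: contra_neq a0 => x0; rewrite -ea x0 mul0r.
have Ax : A x by rewrite AE; exists 1; rewrite ?mulr1 // => a; rewrite mul1r.
exists x => //.
rewrite (t_closureE R_strong_mori iI) (t_closureE R_strong_mori iII) -/A.
apply/seteqP; split.
  apply: v_closure_sub; first exact: scaleI_v_closed.
  apply: prodI_sub => [|i i' /sub_v_closure + /sub_v_closure].
    exact/scaleI_submodule/ideal_submodule.
  rewrite -/A {1}AE => -[e Ee <-] Ai'; exists (e * i'); last by rewrite mulrA.
  exact: Ee.
have vII := @v_closure_v_closed _ (prodI I I).
move=> _ [a Aa <-]; move: a Aa; apply: v_closure_mul_sub => // i Ii.
rewrite mulrC; move: x Ax {AE x0}; apply: v_closure_mul_sub => // i' Ii'.
exact/sub_v_closure/prodI_mul.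
Qed.

Lemma strongly_t_stable_t_stable I :
  ideal I -> strongly_t_stable I -> t_stable I.
Proof.
move=> iI [x]; rewrite /t_stable /t_endo (t_closureE R_strong_mori iI).
have iA := v_closure_ideal iI.
set A := v_closure I in iA *; set E := colon A A => AE.
have vA : v_closed A by exact: v_closure_v_closed.
have oE : overring E by exact: colon_overring.
have vE : v_closed E by exact: colon_v_closed.
have [iE _ E1 [sE EM]] := oE.
have x0 : x != 0.
  have [_ [a + a0] _] := iA; rewrite AE => -[e _ ea].
  by apply: contra_neq a0 => x0; rewrite -ea x0 mul0r.
have iAC := prodI_ideal iA (colon_ideal iE iA).
rewrite t_closureE //; apply/seteqP; split.
  apply: v_closure_sub => //; apply: prodI_sub => // a c Aa.
  by rewrite mulrC; apply.
move=> e Ee; apply: sub_v_closure; rewrite -[e](mulVKf x0).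
apply: prodI_mul; first by rewrite AE; exists 1; rewrite ?mulr1.
move=> a; rewrite AE => -[e' Ee' <-].
have -> : x^-1 * e * (x * e') = (x^-1 * x) * (e * e') by ring.
by rewrite mulVf // mul1r; exact: EM.
Qed.

End Height.

(** Each equivalence is a cycle of three implications. A field is stable in both senses but has
    [t]-dimension zero, which is why it is excluded. *)
Theorem corollary3p10 (R : idomainType)
    (R_not_field : ~ GRing.field_axiom R)
    (R_strong_mori : strong_mori_domain R) :
  [<-> clifford_t_regular_domain R /\ t_dimension_is R 1%N;
       t_stable_domain R;
       clifford_t_regular_domain R /\
         (forall M : set {fraction R}, t_maximal M -> t_stable M)]
  /\
  [<-> boole_t_regular_domain R /\ t_dimension_is R 1%N;
       strongly_t_stable_domain R;
       boole_t_regular_domain R /\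
         (forall M : set {fraction R}, t_maximal M -> t_stable M)].
Proof.
split; (split; last split).
- move=> [cR /t_dimension_one dim1] I iI.
  by apply: clifford_t_stable => //; [exact: dim1|exact: cR].
- move=> stR; split; first by move=> I iI; apply: t_stable_clifford => //; exact: stR.
  by move=> M /t_maximal_ideal; exact: stR.
- move=> [cR stM]; split=> //.
  exact: stable_t_maximal_dimension_one.
- move=> [bR /t_dimension_one dim1] I iI.
  apply: boole_stable_strongly_t_stable => //; first exact: bR.
  apply: clifford_t_stable => //; first exact: dim1.
  by apply: boole_clifford => //; exact: bR.
- move=> stR; split; first by move=> I iI; apply: strongly_t_stable_boole => //; exact: stR.
  move=> M /t_maximal_ideal iM; apply: strongly_t_stable_t_stable => //.
  exact: stR.
- move=> [bR stM]; split=> //.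
  exact: stable_t_maximal_dimension_one.
Qed.
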